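(* Let $R_n:=T(\eta_n,\mathbb{P}_n)-T(\eta_0,P_0)-(\mathbb{P}_n-P_0)\phi_n$ and $R_n^*:=T(\eta_n^*,\mathbb{P}_n^* )-T(\eta_n,\hat{P}_n)-(\mathbb{P}_n^*-\hat{P}_n)\phi_n^*$. Suppose that: (A1) there exists a class $\mathcal{F}$ of measurable functions from $(\mathcal{X},\mathcal{B})$ to $\mathbb{R}$ such that $\phi_0\in\mathcal{F}$, $P_0^*(\phi_n\in\mathcal{F})\to1$, and $\mathbb{G}_n$ converges weakly to the $P_0$-Brownian bridge $\mathbb{G}_0$ in $\ell^\infty(\mathcal{F})$; (A2) $\|\phi_n-\phi_0\|_{L_2(P_0)}=o_{P_0^*}(1)$; (A3) $R_n=o_{P_0^*}(n^{-1/2})$; (B1) there exists a class $\mathcal{F}$ of measurable functions from $(\mathcal{X},\mathcal{B})$ to $\mathbb{R}$ such that $\phi_0\in\mathcal{F}$, $P_W^*(\phi_n^*\in\mathcal{F})\to1$ in $P_0^*$-outer probability, and $\mathbb{G}_n^*$ converges weakly to the $P_0$-Brownian bridge $\mathbb{G}_0$ in $\ell^\infty(\mathcal{F})$ conditionally on the data in outer probability; (B2) $\|\phi_n^*-\phi_0\|_{L_2(P_0)}=o_{P_W^*}(1)$; (B3) $R_n^*=o_{P_W^*}(n^{-1/2})$. Then the bootstrap percentile confidence interval has asymptotic confidence level $1-\alpha-\beta$. If in addition $\sigma_n^2\to\sigma_0^2$ in $P_0^*$-outer probability and $\sigma_n^{*2}-\sigma_0^2=o_{P_W^*}(1)$,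 then the bootstrap percentile $t$-confidence interval has asymptotic confidence level $1-\alpha-\beta$.
   Context: Data and estimator. $X_1,\dots,X_n \in \mathcal{X}\subseteq\mathbb{R}^d$ are IID from a probability measure $P_0$ on $(\mathcal{X},\mathcal{B})$ lying in a statistical model $\mathcal{M}$; $\mathbb{P}_n$ is the empirical distribution; $Pf := \int f\,dP$; $\mathbb{G}_n:=n^{1/2}(\mathbb{P}_n-P_0)$. $\psi:\mathcal{M}\to\mathbb{R}$ is the target parameter, $\psi_0=\psi(P_0)$, and $\phi_0:\mathcal{X}\to\mathbb{R}$ is an influence function, with $P_0\phi_0=0$ and $P_0\phi_0^2<\infty$; $\sigma_0^2:=P_0\phi_0^2$. $\eta:\mathcal{M}\to\mathcal{H}$ is a nuisance parameter, $\eta_0=\eta(P_0)$, and $\eta_n\in\mathcal{H}$ is an estimator of $\eta_0$ based on the data. $T:\mathcal{H}\times\mathcal{M}^+\to\mathbb{R}$, where $\mathcal{M}^+$ is the union of $\mathcal{M}$ and the finite discrete probability measures, is such that $\psi_0=T(\eta_0,P_0)$, and the estimator is $\psi_n=T(\eta_n,\mathbb{P}_n)$. $\phi_n:\mathcal{X}\to\mathbb{R}$ is an estimator of $\phi_0$ based on the data. Bootstrap. $W_{n1},\dots,W_{nn}$ are IID with law $Q_n$ on $(\mathcal{W}_n,\mathcal{C}_n)$, independent of the data, and $X_i^*=\gamma_n(X_1,\dots,X_n,W_{ni})$ for a fixed measurable $\gamma_n$. $\hat{P}_n$ is the conditional law of $X_i^*$ given the data, so $X_1^*,\dots,X_n^*$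 are conditionally IID from $\hat{P}_n$. $\mathbb{P}_n^*$ is the empirical distribution of $X_1^*,\dots,X_n^*$ and $\mathbb{G}_n^* := n^{1/2}(\mathbb{P}_n^*-\hat{P}_n)$. $\eta_n^*\in\mathcal{H}$ is any nuisance estimator based on bootstrap and original data; $T(\eta_n,\hat P_n)$ is assumed well-defined; $\phi_n^*:\mathcal{X}\to\mathbb{R}$ is an estimator of $\phi_0$ that may depend on bootstrap and original data. Intervals. $\alpha,\beta\in(0,1)$, $\alpha+\beta<1$. $\sigma_n$ and $\sigma_n^*$ are estimators of $\sigma_0$ based on the original data and on the bootstrap data, respectively. Let $\xi_{n,p}^*:=\inf\{\xi\in\mathbb{R}:P_W^*([T(\eta_n^*,\mathbb{P}_n^* )-T(\eta_n,\hat{P}_n)]/\sigma_n^*\le\xi)\ge p\}$. The percentile $t$-interval is $[T(\eta_n,\mathbb{P}_n)-\xi_{n,1-\alpha}^*\sigma_n,\;T(\eta_n,\mathbb{P}_n)-\xi_{n,\beta}^*\sigma_n]$. The percentile interval is the same with $\sigma_n=\sigma_n^*=1$ (also in the definition of $\xi_{n,p}^*$). An interval has asymptotic confidence level $1-\alpha-\beta$ if the $P_0^*$-probability that it contains $\psi_0$ converges to $1-\alpha-\beta$. Modes of convergence. $P_0^*$ is outer probability; $Y_n=o_{P_0^*}(r_n)$ means $Y_n/r_n\to0$ in $P_0^*$-outer probability. The conditional outer expectation $E_W^*h$ of a map $h$ of $(X_1,\dots,X_n,W_{n1},\dots,W_{nn})$ is the infimum of $\int U(X_1,\dots,X_n,w)\,dQ_n^n(w)$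 over $U\ge h$ measurable in $w$ with existing integral; $P_W^*(A)=E_W^*1_A$. $Y_n=o_{P_W^*}(r_n)$ means that for every $\varepsilon>0$, $P_W^*(|Y_n|/r_n\ge\varepsilon)\to0$ in $P_0^*$-outer probability. $BL_1(\mathbb{D})$ is the set of 1-Lipschitz $h:\mathbb{D}\to[-1,1]$; $G_n$ converges weakly to a tight Borel measurable $G$ in $\mathbb{D}$ conditionally on the data in outer probability if $\sup_{h\in BL_1(\mathbb{D})}|E_W^*h(G_n)-E_0h(G)|\to0$ in $P_0^*$-outer probability. Unconditional weak convergence is in the Hoffmann–Jørgensen (outer expectation) sense. $\ell^\infty(\mathcal{F})$ is the space of bounded real functions on $\mathcal{F}$ with the supremum norm. The $P_0$-Brownian bridge $\mathbb{G}_0$ is the tight mean-zero Gaussian process with covariance $P_0(fg)-P_0f\,P_0g$.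
   Formalization: Assumes σ_0>0 and that σ_n, σ_n^* are nonnegative; ''P_0^*(φ_n∈F)→1'' and ''P_W^*(φ_n^*∈F)→1'' are read with inner probability (the probability of the complement tends to 0). Without these the claim fails. *)

(* Defs.v *)
From HB Require Import structures.
From mathcomp Require Export all_boot all_order all_algebra.
From mathcomp Require Export all_classical all_reals all_analysis.
From mathcomp Require Export measurable_realfun.

Set Implicit Arguments.
Unset Strict Implicit.
Unset Printing Implicit Defensive.

Export Order.TTheory GRing.Theory Num.Theory.
Export numFieldNormedType.Exports.

#[global] Open Scope classical_set_scope.
#[global] Open Scope ring_scope.

Section linfty_def.
Context (R : realType) (I : Type).

Definition bounded_pred : {pred (I -> R^o)} :=
  fun g => `[< bounded_fun g >].

Record linfty := Linfty {
  linfty_fun :> I -> R^o;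
  linfty_bounded : bounded_pred linfty_fun }.

HB.instance Definition _ := [isSub for linfty_fun].
HB.instance Definition _ := [Choice of linfty by <:].

Lemma bounded_predP (g : I -> R^o) :
  reflect (exists M : R, forall i, `|g i| <= M) (g \in bounded_pred).
Proof.
apply: (iffP (asboolP _)) => [[M [_ gM]]|[M gM]].
- by exists (M + 1) => i; apply: gM => //; rewrite ltrDl.
- exists M; split; first exact: num_real.
  by move=> x Mx i _ /=; apply: (le_trans (gM i)); exact: ltW.
Qed.

Lemma bounded_pred_submod : submod_closed bounded_pred.
Proof.
split=> [|a u v]; first by apply/bounded_predP; exists 0 => i; rewrite normr0.
move=> /bounded_predP[M uM] /bounded_predP[N vN]; apply/bounded_predP.
exists (`|a| * M + N) => i; apply: (le_trans (ler_normD _ _)).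
by apply: lerD => //; rewrite normrZ ler_wpM2l.
Qed.

HB.instance Definition _ :=
  GRing.isSubmodClosed.Build R (I -> R^o) bounded_pred bounded_pred_submod.
HB.instance Definition _ := [SubChoice_isSubLmodule of linfty by <:].

Definition supnorm (g : linfty) : R := sup (range (fun i => `|g i|)).

Let range_ub (g : linfty) : has_ubound (range (fun i => `|g i|)).
Proof.
by have /bounded_predP[M gM] := linfty_bounded g; exists M => _ [j _ <-].
Qed.

Lemma supnorm_ge (g : linfty) i : `|g i| <= supnorm g.
Proof. by apply: ub_le_sup; [exact: range_ub|exists i]. Qed.

Lemma supnorm_le (g : linfty) (M : R) :
  0 <= M -> (forall i, `|g i| <= M) -> supnorm g <= M.
Proof.
move=> M0 gM; rewrite /supnorm.
have [->|/set0P g0] := eqVneq (range (fun i => `|g i|)) set0.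
  by rewrite sup0.
by apply: ge_sup => // _ [i _ <-].
Qed.

Lemma supnorm_ge0 (g : linfty) : 0 <= supnorm g.
Proof.
rewrite /supnorm.
have [->|/set0P[_ [i _ _]]] := eqVneq (range (fun i => `|g i|)) set0.
  by rewrite sup0.
exact: le_trans (normr_ge0 (g i)) (supnorm_ge g i).
Qed.

Lemma supnormD (g h : linfty) : supnorm (g + h) <= supnorm g + supnorm h.
Proof.
apply: supnorm_le => [|i]; first by rewrite addr_ge0 ?supnorm_ge0.
by apply: (le_trans (ler_normD _ _)); rewrite lerD ?supnorm_ge.
Qed.

Lemma supnormZ (a : R) (g : linfty) : supnorm (a *: g) = `|a| * supnorm g.
Proof.
have le b (h : linfty) : supnorm (b *: h) <= `|b| * supnorm h.
  apply: supnorm_le => [|i]; first by rewrite mulr_ge0 ?supnorm_ge0.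
  by rewrite normrZ ler_wpM2l ?supnorm_ge.
apply/eqP; rewrite eq_le le /=; have [->|a0] := eqVneq a 0.
  by rewrite normr0 mul0r supnorm_ge0.
rewrite -ler_pdivlMl ?normr_gt0//.
by have := le a^-1 (a *: g); rewrite scalerA mulVf// scale1r normfV.
Qed.

Lemma supnorm0_eq0 (g : linfty) : supnorm g = 0 -> g = 0.
Proof.
move=> g0; apply/val_inj/funext => i; apply/normr0_eq0/le_anti.
by rewrite normr_ge0 andbT -[X in _ <= X]g0 supnorm_ge.
Qed.

HB.instance Definition _ :=
  Lmodule_isNormed.Build R linfty supnormD supnormZ supnorm0_eq0.

End linfty_def.


Section tuple_product.
Context (R : realType) (d : measure_display) (T : measurableType d).

Definition cons_tuple n (p : T * n.-tuple T) : n.+1.-tuple T :=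
  [the n.+1.-tuple T of p.1 :: p.2].

Lemma measurable_cons_tuple n : measurable_fun [set: T * n.-tuple T] (@cons_tuple n).
Proof. exact: measurable_cons. Qed.

HB.instance Definition _ n :=
  isMeasurableFun.Build _ _ _ _ (@cons_tuple n) (@measurable_cons_tuple n).

Fixpoint tuple_prob (Q : probability T R) (n : nat) : probability (n.-tuple T) R :=
  match n with
  | 0 => \d_[tuple]
  | m.+1 => distribution (Q \x tuple_prob Q m)%E (@cons_tuple m)
  end.

Lemma tuple_prob_box (Q : probability T R) n (A : 'I_n -> set T) :
  (forall i, measurable (A i)) ->
  tuple_prob Q n [set w | forall i, A i (tnth w i)] = (\prod_(i < n) Q (A i))%E.
Proof.
elim: n A => [|n ih] A mA /=.
  rewrite big_ord0 (_ : [set _ | _] = setT) ?diracT//.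
  by apply/seteqP; split => // w _ [].
pose B := [set w : n.-tuple T | forall i, A (lift ord0 i) (tnth w i)].
have mB : measurable B.
  rewrite (_ : B = \bigcap_(i in [set: 'I_n])
      (fun w => tnth w i) @^-1` A (lift ord0 i)); last first.
    by apply/seteqP; split => w /= H i; [move=> _; exact: H|exact: H].
  apply: fin_bigcap_measurable => [|i _]; first exact: finite_finset.
  by rewrite -[X in measurable X]setTI; exact: measurable_tnth.
rewrite big_ord_recl -ih// /distribution /pushforward /=.
rewrite (_ : _ @^-1` _ = A ord0 `*` B) ?product_measure1E//.
apply/seteqP; split => -[x w] /=.
  by move=> H; split => [|i]; [exact: (H ord0)|have := H (lift ord0 i); rewrite tnthS].
by move=> [Ax Bw] i; case: (unliftP ord0 i) => [j ->|->//]; rewrite tnthS.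
Qed.

End tuple_product.

Section outer.
Local Open Scope ereal_scope.
Context (R : realType) (d : measure_display) (Om : measurableType d).
Variable P : probability Om R.

(* The library integral is total, with junk value when the integrals of both
   parts are infinite. *)
Definition integral_exists (U : Om -> \bar R) :=
  \int[P]_w (U^\+ w) < +oo \/ \int[P]_w (U^\- w) < +oo.

Definition outer_expectation (h : Om -> R) : \bar R :=
  ereal_inf ((fun U => \int[P]_w U w) @` [set U : Om -> \bar R |
    [/\ measurable_fun [set: Om] U, integral_exists U
      & forall w, (h w)%:E <= U w]]).

Definition outer_prob (A : set Om) : \bar R := outer_expectation \1_A.

(* For a possibly non-measurable event, "with probability tending to one" has
   to be read with the inner probability: the outer probabilities of [A] and of
   its complement may both be 1. *)
Definition inner_prob (A : set Om) : \bar R := 1 - outer_prob (~` A).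

Definition cvg_outer_prob (Y : nat -> Om -> \bar R) (l : R) :=
  forall e : R, (0 < e)%R ->
    outer_prob [set w | e%:E <= `|Y n w - l%:E|] @[n --> \oo] --> 0.

Definition littleo_outer (Y : nat -> Om -> \bar R) (r : nat -> R) :=
  cvg_outer_prob (fun n w => Y n w * (r n)^-1%:E) 0.

End outer.

(* A map of the original and bootstrap data is a function of the outcome
   [om : Om] carrying the data and of the bootstrap weights [v : V n], whose
   law is [QV n]; conditioning on the data amounts to fixing [om]. *)
Section conditional_outer.
Local Open Scope ereal_scope.
Context (R : realType) (d : measure_display) (Om : measurableType d).
Variable P : probability Om R.
Context (dV : nat -> measure_display) (V : forall n, measurableType (dV n)).
Variable QV : forall n, probability (V n) R.

Definition cond_littleo_outer (Y : forall n, Om -> V n -> \bar R)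
    (r : nat -> R) :=
  forall e : R, (0 < e)%R ->
    cvg_outer_prob P (fun n om =>
      outer_prob (QV n) [set v | e%:E <= `|Y n om v| * (r n)^-1%:E]) 0.

End conditional_outer.

Section weak_convergence.
Local Open Scope ereal_scope.
Context (R : realType) (d : measure_display) (Om : measurableType d).
Variable P : probability Om R.
Context (dV : nat -> measure_display) (V : forall n, measurableType (dV n)).
Variable QV : forall n, probability (V n) R.
Context (D : normedModType R).
Context (dL : measure_display) (OmL : measurableType dL).
Variables (PL : probability OmL R) (G : OmL -> D).

Definition weak_cvg (Z : nat -> Om -> D) :=
  forall h : D -> R, continuous h -> bounded_fun h ->
    outer_expectation P (h \o Z n) @[n --> \oo] --> 'E_PL[h \o G].

Definition BL1 : set (D -> R) :=
  [set h | 1.-lipschitz h /\ forall z, (`|h z| <= 1)%R].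

Definition cond_weak_cvg (Z : forall n, Om -> V n -> D) :=
  cvg_outer_prob P (fun n om =>
    ereal_sup [set `|outer_expectation (QV n) (h \o Z n om) - 'E_PL[h \o G]|
              | h in BL1]) 0.

Definition borel_measurable :=
  measurable_fun [set: OmL] (G : OmL -> g_sigma_algebraType (@open D)).

Definition tight := forall e : R, (0 < e)%R ->
  exists2 K : set D, compact K & (1 - e)%:E <= PL (G @^-1` K).

End weak_convergence.

Section bridge.
Context (R : realType) (d : measure_display) (X : measurableType d).
Variables (P0 : probability X R) (F : set (X -> R)).

Section limit.
Context (dL : measure_display) (OmL : measurableType dL).
Variable PL : probability OmL R.

(* [normal_prob m 0] is not the degenerate normal law at [m]. Gaussian processes
   are those all of whose finite linear combinations are normal. *)
Definition normal_law (Y : OmL -> R) :=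
  exists m s : R, forall A : set (measurableTypeR R), measurable A ->
    PL (Y @^-1` A) = if s == 0 then \d_m A else normal_prob m s A.

Record brownian_bridge (G : OmL -> linfty R F) : Prop := BrownianBridge {
  bridge_index : forall f, F f -> f \in Lfun P0 2%:E;
  bridge_measurable : borel_measurable G;
  bridge_tight : tight PL G;
  bridge_gaussian : forall m (a : 'I_m -> R) (f : 'I_m -> F),
    normal_law (fun w => \sum_(i < m) a i * G w (f i));
  bridge_mean : forall f : F, ('E_PL[fun w => G w f] = 0)%E;
  bridge_covariance : forall f g : F,
    covariance PL (fun w => G w f) (fun w => G w g) =
    (\int[P0]_t (\val f t * \val g t)
     - (\int[P0]_t \val f t) * (\int[P0]_t \val g t))%:E }.

End limit.

Context (dO : measure_display) (Om : measurableType dO).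
Variable P : probability Om R.
Context (dV : nat -> measure_display) (V : forall n, measurableType (dV n)).
Variable QV : forall n, probability (V n) R.

(* [Z] is the process [A], indexed by functions, seen as a map into l^oo(F). *)
Definition cvg_to_bridge (A : nat -> Om -> (X -> R) -> R) :=
  exists (dL : measure_display) (OmL : measurableType dL)
    (PL : probability OmL R) (G0 : OmL -> linfty R F),
  brownian_bridge PL G0 /\
  exists Z : nat -> Om -> linfty R F,
    (forall n om (f : F), Z n om f = A n om (\val f)) /\
    weak_cvg P PL G0 Z.

Definition cond_cvg_to_bridge (A : forall n, Om -> V n -> (X -> R) -> R) :=
  exists (dL : measure_display) (OmL : measurableType dL)
    (PL : probability OmL R) (G0 : OmL -> linfty R F),
  brownian_bridge PL G0 /\
  exists Z : forall n, Om -> V n -> linfty R F,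
    (forall n om v (f : F), Z n om v f = A n om v (\val f)) /\
    cond_weak_cvg P QV PL G0 Z.

End bridge.

Section sampling.
Context (R : realType) (d : measure_display) (X : measurableType d).

Section iid.
Context (dO : measure_display) (Om : measurableType dO).
Variables (P : probability Om R) (P0 : probability X R) (Xs : nat -> Om -> X).

Record iid : Prop := IID {
  iid_measurable : forall i, measurable_fun [set: Om] (Xs i);
  iid_law : forall i (A : set X), measurable A -> P (Xs i @^-1` A) = P0 A;
  iid_indep : forall n (A : 'I_n -> set X), (forall i, measurable (A i)) ->
    P [set om | forall i : 'I_n, A i (Xs i om)] =
    (\prod_(i < n) P (Xs i @^-1` A i))%E }.

End iid.

(* Sample sizes are written [n.+1], so that they are positive. *)
Definition sample (Om : Type) (Xs : nat -> Om -> X) n (om : Om) :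
  n.+1.-tuple X := [tuple Xs i om | i < n.+1].

Definition empirical n (x : n.+1.-tuple X) : set X -> \bar R :=
  mscale (n.+1%:R^-1)%:nng (msum (fun i => \d_(tnth x (inord i))) n.+1).

HB.instance Definition _ n (x : n.+1.-tuple X) :=
  Measure.on (empirical x).

Lemma empirical_setT n (x : n.+1.-tuple X) : empirical x [set: X] = 1%E.
Proof.
rewrite /empirical /mscale /= /msum.
rewrite (eq_bigr (fun=> 1%E)) => [|i _]; last exact: diracT.
by rewrite sumEFin big_const_ord iter_addr addr0 -EFinM mulVf.
Qed.

HB.instance Definition _ n (x : n.+1.-tuple X) :=
  Measure_isProbability.Build _ _ _ (empirical x) (empirical_setT x).

(* [n^(1/2) (Q f - Q' f)] for samples of size [n.+1]. *)
Definition scaled_diff (n : nat) (Q Q' : probability X R) (f : X -> R) : R :=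
  Num.sqrt n.+1%:R * (\int[Q]_t f t - \int[Q']_t f t).

Definition rate (n : nat) : R := (Num.sqrt n.+1%:R)^-1.

Section bootstrap.
Context (dW : measure_display) (W : measurableType dW) (n : nat).
Variable gamma : {mfun (n.+1.-tuple X * W)%type >-> X}.

Definition resample (x : n.+1.-tuple X) (v : W) : X := gamma (x, v).

Lemma measurable_resample x : measurable_fun [set: W] (resample x).
Proof. exact: measurableT_comp. Qed.

HB.instance Definition _ x :=
  isMeasurableFun.Build _ _ _ _ (resample x) (measurable_resample x).

(* The weights being independent of the data, the conditional law of a
   bootstrap observation given the data [x] is the law of [gamma (x, .)]. *)
Definition boot_law (Q : probability W R) (x : n.+1.-tuple X) :
  probability X R := distribution Q (resample x).

Definition boot_sample (x : n.+1.-tuple X) (w : n.+1.-tuple W) :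
  n.+1.-tuple X := [tuple resample x (tnth w i) | i < n.+1].

End bootstrap.

Section interval.
Local Open Scope ereal_scope.
Context (dV : measure_display) (V : measurableType dV).
Variable QV : probability V R.

Definition boot_quantile (D : V -> R) (p : R) : \bar R :=
  ereal_inf [set xi%:E | xi in [set xi : R |
    p%:E <= outer_prob QV [set v | (D v <= xi)%R]]].

(* The bootstrap quantiles of the possibly non-measurable [D] may be infinite,
   so the end points are extended reals. *)
Definition boot_interval (t s : R) (D : V -> R) (alpha beta : R) : set R :=
  [set z | t%:E - boot_quantile D (1 - alpha) * s%:E <= z%:E
             <= t%:E - boot_quantile D beta * s%:E].

End interval.

Definition asymptotic_level (dO : measure_display) (Om : measurableType dO)
    (P : probability Om R) (CI : nat -> Om -> set R) (theta level : R) :=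
  outer_prob P [set om | CI n om theta] @[n --> \oo] --> level%:E.

End sampling.

Arguments empirical {R d X n} x.
Arguments rate {R} n.

(* Main.v *)
From HB Require Import structures.
Require Import Defs.
From mathcomp Require Import ring lra.

(** Why the corollary is true. Put [r = sqrt n]. The root [r (psi_n - psi_0)]
    is [G_n phi_n + r R_n], and the bootstrap root, the centered bootstrap
    estimate times [r], is [G_n^* phi_n^* + r R_n^*]. The remainders are
    negligible, so the influence function estimates have to be replaced by
    [phi0], after which both roots have the same normal limit.

    The replacement rests on the equicontinuity of the limit process
    ([bridge_equicontinuity]). A compact set of paths carrying almost all the
    mass lies within [e] of finitely many bounded functions; sorting the index
    functions by the approximate values of these splits the index set into
    finitely many cells on which every path of the compact set varies by at
    most a multiple of [e]. In a small L2 ball around [phi0] it is then enough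
    to control one representative per cell, which Chebyshev's inequality does,
    because an increment of the bridge has at most the squared L2 distance of
    its indices as variance. The number of cells does not depend on the radius
    of the ball, which can thus be taken small. The oscillation over the ball
    is a Lipschitz functional of the path, so weak convergence carries the
    bound over to the empirical and to the bootstrap process: the two roots
    are [G_n phi0] and [G_n^* phi0] up to negligible terms
    ([cond_linearization]).

    The limits in (A1) and in (B1) are evaluated at [phi0] on possibly
    different classes and probability spaces, but both values are centered
    normal with variance [sigma0 ^ 2], and this determines their law
    ([centered_normal], [normal_cdf_unique]), with a continuous and strictly
    increasing distribution function [Phi].

    Outer probabilities are only subadditive, and events cannot be handled
    through their complements. Hence every limit of outer probabilities is
    obtained by sandwiching the event between Lipschitz functions of the
    process, up to events of vanishing outer probability
    ([cond_portmanteau]). This gives the convergence of the conditional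
    distribution functions of the studentized bootstrap root, then that of its
    quantiles ([boot_quantile_cvg]). Up to a vanishing event the interval
    covers [psi_0] exactly when the root lies between two random bounds that
    converge to the [beta] and [1 - alpha] quantiles of [Phi], and the outer
    probability of this tends to [1 - alpha - beta] ([boot_interval_level]).
    The percentile interval and the percentile t-interval are the cases where
    the scale estimates converge to 1 and to [sigma0].

    Statements about the data alone are treated as conditional ones, with the
    data space in the role of the space of bootstrap weights and nothing
    depending on the conditioning; [cond_vanishing_cst] and
    [cvg_outer_prob_outer_prob] translate between the two forms. *)

Set Implicit Arguments.
Unset Strict Implicit.
Unset Printing Implicit Defensive.

(** * Outer expectations of nonnegative functions *)

Definition unit_valued (R : realType) (T : Type) (h : T -> R) :=
  forall t, 0 <= h t <= 1.

Lemma indic_unit_valued (R : realType) (T : Type) (A : set T) :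
  unit_valued (\1_A : T -> R).
Proof. by move=> w; rewrite indicE; case: (_ \in _); rewrite ?lexx ler01. Qed.

Section outer_expectation_nonneg.
Local Open Scope ereal_scope.
Context (R : realType) (d : measure_display) (Om : measurableType d).
Variable P : probability Om R.
Implicit Types (h : Om -> R) (A B : set Om).

Lemma outer_expectation_ge0 h : (forall w, (0 <= h w)%R) ->
  0 <= outer_expectation P h.
Proof.
move=> h0; apply: le_ereal_inf_tmp => _ [U [mU _ hU] <-].
by apply: integral_ge0 => w _; apply: le_trans (hU w); rewrite lee_fin.
Qed.

Lemma outer_expectation_le_integral h (U : Om -> \bar R) :
  measurable_fun [set: Om] U -> (forall w, (0 <= h w)%R) ->
  (forall w, (h w)%:E <= U w) -> outer_expectation P h <= \int[P]_w U w.
Proof.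
move=> mU h0 hU; apply: ge_ereal_inf; exists (\int[P]_w U w) => //.
exists U => //; split=> //; right.
rewrite (eq_integral (cst 0)) ?integral0 ?ltry// => w _.
rewrite (@ge0_funenegE _ _ setT) ?inE// => v _.
by apply: le_trans (hU v); rewrite lee_fin.
Qed.

Lemma outer_expectation_le h h' : (forall w, (h w <= h' w)%R) ->
  outer_expectation P h <= outer_expectation P h'.
Proof.
move=> hh'; apply: ereal_inf_le_tmp => _ [U [mU iU hU] <-].
exists U => //; split=> // w; apply: le_trans (hU w).
by rewrite lee_fin.
Qed.

Lemma outer_expectation_cst (r : R) : (0 <= r)%R ->
  outer_expectation P (cst r) = r%:E.
Proof.
move=> r0; have intr : \int[P]_w (cst r%:E) w = r%:E.
  by rewrite integral_cst//= probability_setT mule1.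
apply/eqP; rewrite eq_le; apply/andP; split.
  by rewrite -[leRHS]intr; apply: outer_expectation_le_integral.
apply: le_ereal_inf_tmp => _ [U [mU _ hU] <-]; rewrite -[leLHS]intr.
by apply: ge0_le_integral => // w _; apply: le_trans (hU w); rewrite lee_fin.
Qed.

Lemma outer_expectationE h : unit_valued h ->
  exists2 r : R, (0 <= r <= 1)%R & outer_expectation P h = r%:E.
Proof.
move=> h01; have h0 w : (0 <= h w)%R by have /andP[] := h01 w.
have := outer_expectation_ge0 h0.
have : outer_expectation P h <= 1%:E.
  rewrite -(outer_expectation_cst ler01); apply: outer_expectation_le => w.
  by have /andP[] := h01 w.
case: (outer_expectation P h) => [r r1 r0|//|//].
by exists r => //; rewrite -!lee_fin r0 r1.
Qed.

(** Subadditivity. The bounds by 1 make the two outer expectations finite, so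
    that measurable majorants of [h1] and [h2] can be optimized separately. *)
Lemma outer_expectation_leD h h1 h2 :
  unit_valued h1 -> unit_valued h2 -> (forall w, (0 <= h w)%R) ->
  (forall w, (h w <= h1 w + h2 w)%R) ->
  outer_expectation P h <= outer_expectation P h1 + outer_expectation P h2.
Proof.
move=> h1u h2u h0 hh.
have [r1 _ E1] := outer_expectationE h1u.
have [r2 _ E2] := outer_expectationE h2u.
rewrite -leeBlDl ?E1//; apply: le_ereal_inf_tmp => _ [U2 [mU2 _ hU2] <-].
have U20 w : 0 <= U2 w.
  by apply: le_trans (hU2 w); rewrite lee_fin; have /andP[] := h2u w.
rewrite -E1; have [->|U2y] := eqVneq (\int[P]_w U2 w) +oo; first by rewrite leey.
have U2fin : \int[P]_w U2 w \is a fin_num.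
  by rewrite ge0_fin_numE ?integral_ge0// ltey.
rewrite leeBlDl ?E1// -leeBlDr// -E1.
apply: le_ereal_inf_tmp => _ [U1 [mU1 _ hU1] <-].
have U10 w : 0 <= U1 w.
  by apply: le_trans (hU1 w); rewrite lee_fin; have /andP[] := h1u w.
rewrite leeBlDr// -ge0_integralD//.
apply: outer_expectation_le_integral => //; first exact: emeasurable_funD.
move=> w; apply: (@le_trans _ _ (h1 w + h2 w)%:E); first by rewrite lee_fin.
by rewrite EFinD leeD.
Qed.

Lemma outer_expectationZ (c : R) h : (0 < c)%R -> (forall w, (0 <= h w)%R) ->
  outer_expectation P (fun w => c * h w)%R = c%:E * outer_expectation P h.
Proof.
have le (b : R) g : (0 < b)%R -> (forall w, (0 <= g w)%R) ->
    b%:E * outer_expectation P g <= outer_expectation P (fun w => b * g w)%R.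
  move=> b0 g0; apply: le_ereal_inf_tmp => _ [U [mU _ gU] <-].
  have U0 w : 0 <= U w.
    by apply: le_trans (gU w); rewrite lee_fin mulr_ge0// ltW.
  rewrite -lee_pdivlMl// -ge0_integralZl//; last by rewrite lee_fin invr_ge0 ltW.
  apply: outer_expectation_le_integral => //; first exact: measurable_funeM.
  by move=> w; rewrite lee_pdivlMl// -EFinM.
move=> c0 h0; apply/eqP; rewrite eq_le le// andbT.
have ch0 w : (0 <= c * h w)%R by rewrite mulr_ge0// ltW.
have := le c^-1%R (fun w => c * h w)%R.
rewrite invr_gt0 => /(_ c0 ch0); rewrite lee_pdivrMl//.
by under [X in _ <= _ * outer_expectation P X]funext do rewrite mulKf ?gt_eqF//.
Qed.

Lemma outer_probE A :
  exists2 r : R, (0 <= r <= 1)%R & outer_prob P A = r%:E.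
Proof. by apply: outer_expectationE; exact: indic_unit_valued. Qed.

Lemma outer_prob_ge0 A : 0 <= outer_prob P A.
Proof. by have [r /andP[r0 _] ->] := outer_probE A; rewrite lee_fin. Qed.

Lemma indic_le A B : A `<=` B -> forall w, ((\1_A w : R) <= \1_B w)%R.
Proof.
move=> AB w; rewrite !indicE.
have [/set_mem/AB/mem_set ->//|_] := boolP (w \in A).
by case: (_ \in _).
Qed.

Lemma outer_prob_le A B : A `<=` B -> outer_prob P A <= outer_prob P B.
Proof. by move=> AB; apply: outer_expectation_le; exact: indic_le. Qed.

Lemma outer_probU A B :
  outer_prob P (A `|` B) <= outer_prob P A + outer_prob P B.
Proof.
apply: outer_expectation_leD; try exact: indic_unit_valued.
  by move=> w; have /andP[] := indic_unit_valued R (A `|` B) w.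
move=> w; rewrite !indicE in_setU.
by do 2 case: (_ \in _); rewrite /= ?addr0 ?add0r ?lexx// ler_wpDr.
Qed.

Lemma outer_prob0 : outer_prob P set0 = 0.
Proof. by rewrite /outer_prob indic0 outer_expectation_cst. Qed.

Lemma outer_probT : outer_prob P setT = 1.
Proof. by rewrite /outer_prob indicT outer_expectation_cst. Qed.

End outer_expectation_nonneg.

(** * Events of vanishing outer probability *)

Section vanishing.
Local Open Scope ereal_scope.
Context (R : realType) (d : measure_display) (Om : measurableType d).
Variable P : probability Om R.

Definition vanishing (A : nat -> set Om) :=
  outer_prob P (A n) @[n --> \oo] --> 0.

Lemma vanishing_sub (A B : nat -> set Om) : (forall n, A n `<=` B n) ->
  vanishing B -> vanishing A.
Proof.
move=> AB B0; apply: (squeeze_cvge _ (cvg_cst 0) B0); apply: nearW => n.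
by rewrite outer_prob_ge0 outer_prob_le.
Qed.

Lemma vanishingU (A B : nat -> set Om) :
  vanishing A -> vanishing B -> vanishing (fun n => A n `|` B n).
Proof.
move=> A0 B0.
have AB0 : outer_prob P (A n) + outer_prob P (B n) @[n --> \oo] --> 0.
  by rewrite -[0]adde0; exact: cvgeD.
apply: (squeeze_cvge _ (cvg_cst 0) AB0); apply: nearW => n.
by rewrite outer_prob_ge0 outer_probU.
Qed.

Lemma vanishing_empty (A : nat -> set Om) : (forall n w, ~ A n w) ->
  vanishing A.
Proof.
move=> A0; apply: cvg_near_cst; apply: nearW => n.
by rewrite (_ : A n = set0) ?outer_prob0// -subset0 => w /A0.
Qed.

(** For constants, the outer probability of a deviation is 0 or 1. *)
Lemma cvg_outer_prob_cst (a : nat -> R) (l : R) :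
  cvg_outer_prob P (fun n _ => (a n)%:E) l <-> (a n @[n --> \oo] --> l)%R.
Proof.
split=> al.
  apply/cvgrPdist_lt => e e0.
  have /fine_cvgP[_ /cvgrPdist_lt/(_ _ ltr01)] := al _ e0.
  apply: filterS => n /=; rewrite sub0r normrN distrC [in X in _ -> X]ltNge.
  apply: contraTN => ean.
  rewrite (_ : [set _ | _] = setT) ?outer_probT ?normr1 ?ltxx//.
  rewrite -subTset => w _ /=. by rewrite lee_fin.
move=> e e0; apply: cvg_near_cst.
have /cvgrPdist_lt/(_ _ e0) := al; apply: filterS => n ean.
rewrite (_ : [set _ | _] = set0) ?outer_prob0//.
rewrite -subset0 => w /=; rewrite lee_fin leNgt.
by rewrite distrC ean.
Qed.

End vanishing.

Section cond_vanishing.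
Local Open Scope ereal_scope.
Context (R : realType) (d : measure_display) (Om : measurableType d).
Variable P : probability Om R.
Context (dV : nat -> measure_display) (V : forall n, measurableType (dV n)).
Variable QV : forall n, probability (V n) R.

(** The negation of a [cond_vanishing] event has conditional probability
    tending to one in the sense of inner probability. *)
Definition cond_vanishing (B : forall n, Om -> set (V n)) :=
  cvg_outer_prob P (fun n om => outer_prob (QV n) (B n om)) 0.

Lemma cond_vanishing_sub (A B : forall n, Om -> set (V n)) :
  (forall n om, A n om `<=` B n om) -> cond_vanishing B -> cond_vanishing A.
Proof.
move=> AB B0 e e0; apply: vanishing_sub (B0 _ e0) => n om /=.
rewrite !sube0 !gee0_abs ?outer_prob_ge0// => /le_trans; apply.
exact: outer_prob_le.
Qed.

Lemma cond_vanishingU (A B : forall n, Om -> set (V n)) :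
  cond_vanishing A -> cond_vanishing B ->
  cond_vanishing (fun n om => A n om `|` B n om).
Proof.
move=> A0 B0 e e0; have e20 : (0 < e / 2)%R by rewrite divr_gt0.
apply: vanishing_sub (vanishingU (A0 _ e20) (B0 _ e20)) => n om /=.
rewrite !sube0 !gee0_abs ?outer_prob_ge0//.
have [a _ aE] := outer_probE (QV n) (A n om).
have [b _ bE] := outer_probE (QV n) (B n om).
move=> /le_trans/(_ (outer_probU _ _ _)); rewrite aE bE -EFinD !lee_fin => eab.
by have [|] := lerP (e / 2) a; [left|right]; lra.
Qed.

Lemma cond_vanishing_empty (A : forall n, Om -> set (V n)) :
  (forall n om v, ~ A n om v) -> cond_vanishing A.
Proof.
move=> A0 e e0; apply: vanishing_empty => n om /=.
rewrite (_ : A n om = set0) ?outer_prob0; last by rewrite -subset0 => v /A0.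
by rewrite sube0 abse0 lee_fin leNgt e0.
Qed.

End cond_vanishing.

Section cond_vanishing_cst.
Local Open Scope ereal_scope.
Context (R : realType) (d : measure_display) (Om : measurableType d).
Variable P : probability Om R.

Lemma cvg_outer_prob_outer_prob (A : nat -> set Om) (l : R) :
  cvg_outer_prob P (fun n _ => outer_prob P (A n)) l <->
  outer_prob P (A n) @[n --> \oo] --> l%:E.
Proof.
pose a n := fine (outer_prob P (A n)).
have aE : (fun n => outer_prob P (A n)) = EFin \o a.
  by apply/funext => n /=; rewrite /a; have [r _ ->] := outer_probE P (A n).
rewrite aE; have -> : (fun n _ => outer_prob P (A n)) = fun n (_ : Om) => (a n)%:E.
  by apply/funext => n; apply/funext => _; rewrite -[RHS]/((EFin \o a) n) -aE.
rewrite cvg_outer_prob_cst; split=> [al|/fine_cvg//].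
by apply/fine_cvgP; split; first exact: nearW.
Qed.

Lemma cond_vanishing_cst (A : nat -> set Om) :
  cond_vanishing P (fun=> P) (fun n _ => A n) <-> vanishing P A.
Proof. exact: cvg_outer_prob_outer_prob. Qed.

End cond_vanishing_cst.

(** * Weak convergence tested on Lipschitz functions *)

(** Both notions of weak convergence apply to these functions: they are bounded
    and continuous, and up to a positive factor they belong to [BL1]. *)
Definition test_function (R : realType) (D : normedModType R) (h : D -> R) :=
  unit_valued h /\
  exists2 K : R, 0 < K & forall z z', `|h z - h z'| <= K * `|z - z'|.

Section test_functions.
Context (R : realType) (D : normedModType R).
Implicit Types h : D -> R.

Lemma lipschitz_fun_continuous h (K : R) : 0 < K ->
  (forall z z', `|h z - h z'| <= K * `|z - z'|) -> continuous h.
Proof.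
move=> K0 hK z; apply/cvgrPdist_lt => e e0.
near=> z'; apply: (le_lt_trans (hK _ _)).
rewrite -ltr_pdivlMl//; near: z'; apply: cvgr_dist_lt.
  exact: cvg_id.
by rewrite mulrC divr_gt0.
Unshelve. all: end_near. Qed.

Lemma test_function_continuous h : test_function h -> continuous h.
Proof. by move=> [_ [K K0 hK]]; exact: lipschitz_fun_continuous hK. Qed.

Lemma test_function_bounded h : test_function h -> bounded_fun h.
Proof.
move=> [h01 _]; exists 1; split=> // M M1 z _ /=.
by have /andP[h0 h1] := h01 z; rewrite ger0_norm// (le_trans h1)// ltW.
Qed.

End test_functions.

Section borel.
Local Open Scope ereal_scope.
Context (R : realType) (D : normedModType R).
Context (dL : measure_display) (OmL : measurableType dL).
Variables (PL : probability OmL R) (G : OmL -> D).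
Hypothesis mG : borel_measurable G.

Lemma measurable_continuous_comp (h : D -> R) : continuous h ->
  measurable_fun [set: OmL] (h \o G).
Proof.
move=> ch; apply: (measurability _ (RGenOpens.measurableE R)).
move=> _ [_ [a [b ->]] <-]; rewrite setTI comp_preimage -[X in measurable X]setTI.
apply: mG => //; apply: sub_sigma_algebra.
by move/continuousP : ch; apply; exact: interval_open.
Qed.

Lemma test_function_expectation (h : D -> R) : test_function h ->
  exists2 r : R, (0 <= r <= 1)%R & 'E_PL[h \o G] = r%:E.
Proof.
move=> th; have mh := measurable_continuous_comp (test_function_continuous th).
have [h01 _] := th.
have h0 w : (0 <= h (G w))%R by have /andP[] := h01 (G w).
have := expectation_ge0 PL h0.
have : 'E_PL[h \o G] <= 'E_PL[cst 1%R].
  apply: expectation_le => //; apply: aeW => w /=.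
  by have /andP[] := h01 (G w).
rewrite expectation_cst; case: ('E_PL[h \o G]) => [r r1 r0|//|//].
by exists r => //; rewrite -!lee_fin r0 r1.
Qed.

Lemma test_function_expectation_le (h : D -> R) (A : set OmL) :
  test_function h -> measurable A -> (forall w, ~ A w -> h (G w) = 0%R) ->
  'E_PL[h \o G] <= PL A.
Proof.
move=> th mA hA; rewrite -(expectation_indic _ mA).
have mh := measurable_continuous_comp (test_function_continuous th).
have [h01 _] := th.
apply: expectation_le => //.
- by move=> w; have /andP[] := h01 (G w).
- apply: aeW => w /=; rewrite indicE.
  have [_|wA] := boolP (w \in A); first by have /andP[] := h01 (G w).
  by rewrite hA// => /mem_set; exact/negP.
Qed.

Lemma test_function_expectation_ge (h : D -> R) (A : set OmL) :
  test_function h -> measurable A -> (forall w, A w -> h (G w) = 1%R) ->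
  PL A <= 'E_PL[h \o G].
Proof.
move=> th mA hA; rewrite -(expectation_indic _ mA).
have mh := measurable_continuous_comp (test_function_continuous th).
have [h01 _] := th.
apply: expectation_le => //.
- by move=> w; have /andP[] := h01 (G w).
- apply: aeW => w /=; rewrite indicE.
  have [/set_mem/hA ->//|_] := boolP (w \in A).
  by have /andP[] := h01 (G w).
Qed.

End borel.

Section cond_cvg_law.
Local Open Scope ereal_scope.
Context (R : realType) (d : measure_display) (Om : measurableType d).
Variable P : probability Om R.
Context (dV : nat -> measure_display) (V : forall n, measurableType (dV n)).
Variable QV : forall n, probability (V n) R.
Context (D : normedModType R).
Context (dL : measure_display) (OmL : measurableType dL).
Variables (PL : probability OmL R) (G : OmL -> D).

(** The common consequence of the conditional and the unconditional weak
    convergence from which the limit theorems below are derived. *)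
Definition cond_cvg_law (Z : forall n, Om -> V n -> D) :=
  forall h, test_function h -> cvg_outer_prob P
    (fun n om => outer_expectation (QV n) (h \o Z n om)) (fine 'E_PL[h \o G]).

(** A [K]-Lipschitz function becomes a member of [BL1] after division by
    [K + 1], and outer expectations are positively homogeneous. *)
Lemma cond_weak_cvg_law (Z : forall n, Om -> V n -> D) : borel_measurable G ->
  cond_weak_cvg P QV PL G Z -> cond_cvg_law Z.
Proof.
move=> mG ZG h th; have [h01 [K K0 hK]] := th.
have c0 : (0 < K + 1)%R by rewrite addr_gt0.
pose g z := ((K + 1)^-1 * h z)%R.
have g01 : unit_valued g.
  move=> z; have /andP[hz0 hz1] := h01 z.
  rewrite /g mulr_ge0 ?invr_ge0 ?(ltW c0)//= mulrC ler_pdivrMr// mul1r.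
  by rewrite (le_trans hz1)// lerDr ltW.
have hg z : h z = ((K + 1) * g z)%R by rewrite mulrA mulfV ?mul1r// gt_eqF.
have g0 z : (0 <= g z)%R by have /andP[] := g01 z.
have BLg : BL1 g.
  split=> [[z z'] _ /=|z]; last first.
    by have /andP[gz0 gz1] := g01 z; rewrite ger0_norm.
  rewrite mul1r -mulrBr normrM gtr0_norm ?invr_gt0// mulrC ler_pdivrMr//.
  by rewrite mulrC (le_trans (hK z z'))// ler_wpM2r// lerDl.
have tg : test_function g.
  split; [exact: g01|exists 1%R; first exact: ltr01] => y y'.
  by have [lipg _] := BLg; apply: (lipg (y, y')).
have Eg : 'E_PL[h \o G] = (K + 1)%:E * 'E_PL[g \o G].
  rewrite unlock -ge0_integralZl//=; last 3 first.
  - apply/measurable_EFinP.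
    exact: (measurable_continuous_comp mG (test_function_continuous tg)).
  - by move=> w _; rewrite lee_fin.
  - by rewrite lee_fin ltW.
  by apply: eq_integral => w _; rewrite -EFinM -hg.
move=> e e0; have ec0 : (0 < e / (K + 1))%R by rewrite divr_gt0.
apply: vanishing_sub (ZG _ ec0) => n om /=; rewrite sube0 => eh.
apply: le_trans (lee_abs _); apply: ereal_sup_ge.
exists (`|outer_expectation (QV n) (g \o Z n om) - 'E_PL[g \o G]|).
  by exists g.
move: eh; rewrite Eg (_ : h \o Z n om = fun v => (K + 1) * (g \o Z n om) v)%R; last first.
  by apply/funext => v /=; rewrite -hg.
rewrite outer_expectationZ//; last by move=> v /=.
have [a _ ->] := outer_expectationE (QV n) (fun v => g01 (Z n om v)).
have [b _ ->] := test_function_expectation PL mG tg.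
rewrite -!EFinM/= !lee_fin -mulrBr normrM (gtr0_norm c0).
by rewrite ler_pdivrMr// mulrC.
Qed.

End cond_cvg_law.

Section cvg_law.
Local Open Scope ereal_scope.
Context (R : realType) (d : measure_display) (Om : measurableType d).
Variable P : probability Om R.
Context (D : normedModType R).
Context (dL : measure_display) (OmL : measurableType dL).
Variables (PL : probability OmL R) (G : OmL -> D).

Lemma weak_cvg_law (Z : nat -> Om -> D) : borel_measurable G ->
  weak_cvg P PL G Z -> cond_cvg_law P (fun=> P) PL G (fun n _ => Z n).
Proof.
move=> mG ZG h th.
have := ZG h (test_function_continuous th) (test_function_bounded th).
have [r _ ->] := test_function_expectation PL mG th.
pose a n := fine (outer_expectation P (h \o Z n)).
have aE n : outer_expectation P (h \o Z n) = (a n)%:E.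
  by rewrite /a; have [h01 _] := th;
    have [s _ ->] := outer_expectationE P (fun w => h01 (Z n w)).
under eq_fun do rewrite aE.
move=> /fine_cvgP[_ ar].
have {}ar : cvg_outer_prob P (fun n _ => (a n)%:E) r by exact/cvg_outer_prob_cst.
by move=> e /ar; apply: vanishing_sub => n om /=; rewrite aE.
Qed.

End cvg_law.

(** * Ramps, finite colorings and compact nets *)

Section ramp.
Context (R : realType).
Implicit Types a e x y : R.

(** The Lipschitz substitute for the indicator of a half-line: 0 up to [a], 1
    from [a + e] on. *)
Definition ramp a e x : R := Num.min 1 (Num.max 0 ((x - a) / e)).

Lemma ramp_unit_valued a e : unit_valued (ramp a e).
Proof. by move=> x; rewrite /ramp le_min ler01 le_max lexx/= ge_min lexx. Qed.

Lemma ramp0 a e x : 0 < e -> x <= a -> ramp a e x = 0.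
Proof.
move=> e0 xa; rewrite /ramp max_l ?min_r//.
by rewrite pmulr_lle0 ?invr_gt0// subr_le0.
Qed.

Lemma ramp1 a e x : 0 < e -> a + e <= x -> ramp a e x = 1.
Proof.
move=> e0 xa; rewrite /ramp min_l// le_max ler_pdivlMr//.
by rewrite mul1r lerBrDl xa orbT.
Qed.

Lemma ramp_lipschitz a e x y : 0 < e ->
  `|ramp a e x - ramp a e y| <= e^-1 * `|x - y|.
Proof.
move=> e0; have clamp (u v : R) : u <= v ->
    0 <= Num.min 1 (Num.max 0 v) - Num.min 1 (Num.max 0 u) <= v - u.
  move=> uv; apply/andP; rewrite !minElt !maxElt.
  by do ! case: ifPn => [|]; rewrite -?leNgt => *; split; lra.
wlog xy : x y / x <= y => [hw|].
  have /orP[|] := le_total x y; first exact: hw.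
  by move=> /hw; rewrite distrC (distrC x).
have /clamp/andP[r0] : (x - a) / e <= (y - a) / e.
  by rewrite ler_pM2r ?invr_gt0// lerD2r.
rewrite distrC ger0_norm// => /le_trans; apply.
by rewrite distrC ger0_norm ?subr_ge0// -mulrBl mulrC opprB addrA subrK.
Qed.

End ramp.

Section coloring.
Context (R : realType) (I : Type).

Lemma linfty_dist_ge (z z' : linfty R I) i : `|z i - z' i| <= `|z - z'|.
Proof. exact: (supnorm_ge (z - z') i). Qed.

(** The color of [i] is the number of the cell of length [e] that contains
    [g i]; a bounded function meets finitely many cells. *)
Lemma bounded_coloring (g : linfty R I) (e : R) : 0 < e ->
  exists N (c : I -> 'I_N), forall i j, c i = c j -> `|g i - g j| <= e.
Proof.
move=> e0; pose t i := (g i + `|g|) / e.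
have g_ge i : - `|g| <= g i by have := supnorm_ge g i; rewrite ler_norml => /andP[].
have g_le i : g i <= `|g| by have := supnorm_ge g i; rewrite ler_norml => /andP[].
have t0 i : 0 <= t i by rewrite divr_ge0 ?(ltW e0)// -lerBlDr sub0r.
have tN i : (Num.trunc (t i) < (Num.trunc ((`|g| + `|g|) / e)).+1)%N.
  by rewrite ltnS; apply: le_truncn; rewrite ler_pM2r ?invr_gt0// lerD2r.
exists _, (fun i => Ordinal (tN i)) => i j /(congr1 val)/= ij.
have /andP[i0 i1] := truncn_itv (t0 i).
have /andP[j0 j1] := truncn_itv (t0 j).
have -> : g i - g j = (t i - t j) * e by rewrite /t; field; rewrite gt_eqF.
rewrite normrM (gtr0_norm e0) ler_piMl ?(ltW e0)//.
move: i0 i1 j0 j1; rewrite ij -natr1 ler_norml; lra.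
Qed.

Lemma finite_coloring (s : seq (linfty R I)) (e : R) : 0 < e ->
  exists N (c : I -> 'I_N),
    forall i j, c i = c j -> forall g, g \in s -> `|g i - g j| <= e.
Proof.
move=> e0; elim: s => [|g s [N [c cP]]].
  by exists 1%N, (fun=> ord0).
have [N' [c' c'P]] := bounded_coloring g e0.
exists #|{: 'I_N * 'I_N'}|, (fun i => enum_rank (c i, c' i)) => i j.
move=> /enum_rank_inj[/cP ij /c'P ij'] h; rewrite inE => /orP[/eqP ->//|].
exact: ij.
Qed.

End coloring.

Lemma compact_net (R : realType) (D : normedModType R) (K : set D) (e : R) :
  compact K -> 0 < e ->
  exists s : seq D, forall z, K z -> exists2 y, y \in s & `|y - z| < e.
Proof.
move=> + e0; rewrite compact_cover => /(_ D K (fun z => ball z e)).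
have Kcov : K `<=` cover K (fun z => ball z e).
  by move=> z Kz; exists z => //; exact: ballxx.
move=> /(_ (fun z _ => ball_open z e) Kcov)[K' _ KK'].
exists (finmap.enum_fset K') => z /KK'[y /= yK' yz]; exists y => //.
by move: yz; rewrite -ball_normE.
Qed.

(** * Moments of the Brownian bridge *)

Section bridge_moments.
Local Open Scope ereal_scope.
Context (R : realType) (dX : measure_display) (X : measurableType dX).
Variables (P0 : probability X R) (F : set (X -> R)).
Context (dL : measure_display) (OmL : measurableType dL).
Variables (PL : probability OmL R) (G : OmL -> linfty R F).
Hypothesis bG : brownian_bridge P0 PL G.

Lemma bridge_coordinate_measurable (f : F) :
  measurable_fun [set: OmL] (fun w => G w f).
Proof.
apply: (measurable_continuous_comp (bridge_measurable bG)
  (h := fun z : linfty R F => z f)).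
apply: (@lipschitz_fun_continuous _ _ _ 1) => // z z'.
by rewrite mul1r linfty_dist_ge.
Qed.

Lemma bridge_sqr (f : F) :
  'E_PL[fun w => ((G w f : R) ^+ 2)%R] = covariance PL (fun w => G w f) (fun w => G w f).
Proof.
rewrite [in RHS]unlock (bridge_mean bG) /=.
by congr expectation; apply/funext => w; rewrite /= !fctE /= !subr0 expr2.
Qed.

(** The second moment is a covariance, which the definition of the bridge makes
    a real number. *)
Lemma bridge_Lfun2 (f : F) : (fun w => G w f) \in Lfun PL 2%:E.
Proof.
have mGf := bridge_coordinate_measurable f.
rewrite inE; apply/andP; split; first by rewrite inE.
rewrite !inE/= /finite_norm unlock /Lnorm; apply: poweR_lty.
have := bridge_sqr f; rewrite (bridge_covariance bG) unlock.
set m := (X in _ = X%:E) => E; apply: (@le_lt_trans _ _ m%:E); last exact: ltry.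
rewrite -E le_eqVlt; apply/orP; left; apply/eqP; apply: eq_integral => w _.
by rewrite /= powR_mulrn// real_normK ?num_real.
Qed.

(** The coordinate map is an isometry for the covariance forms, so that the
    variance of an increment is that of a difference of functions. *)
Lemma bridge_covarianceE (f g : F) :
  covariance PL (fun w => G w f) (fun w => G w g) = covariance P0 (\val f) (\val g).
Proof.
have L2 (h : F) : \val h \in Lfun P0 2%:E.
  by apply: (bridge_index bG); exact: set_valP.
have fin1 : P0 [set: X] \is a fin_num by rewrite probability_setT.
have L1 (h : F) : \val h \in Lfun P0 1 by exact: Lfun_subset12 fin1 _ (L2 h).
have LM : (\val f \* \val g)%R \in Lfun P0 1 by exact: Lfun2_mul_Lfun1.
have fineE (h : X -> R) : h \in Lfun P0 1 ->
    'E_P0[h] = (\int[P0]_t h t)%R%:E.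
  by move=> /expectation_fin_num; rewrite unlock => /fineK.
by rewrite (bridge_covariance bG) covarianceE// EFinB EFinM !fineE.
Qed.

(** The variance of [G f - G g] is that of [f - g] under [P0], hence at most
    the second moment of [f - g]. *)
Lemma bridge_chebyshev (f g : F) (e r : R) : (0 < e)%R ->
  Lnorm P0 2%:E (EFin \o (\val f \- \val g)%R) <= r%:E ->
  PL [set w | (e <= `|G w f - G w g|)%R] <= (e ^- 2 * r ^+ 2)%:E.
Proof.
move=> e0 fgr.
have L2 (h : F) : \val h \in Lfun P0 2%:E.
  by apply: (bridge_index bG); exact: set_valP.
pose Y w := (G w f - G w g)%R.
have mY : measurable_fun [set: OmL] Y.
  by apply: measurable_funB; exact: bridge_coordinate_measurable.
pose Ym : {RV PL >-> R} := mfun_Sub (mem_set mY).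
have L1G (h : F) : (fun w => G w h) \in Lfun PL 1.
  have finL : PL [set: OmL] \is a fin_num by rewrite probability_setT.
  exact: Lfun_subset12 finL _ (bridge_Lfun2 h).
have EY : 'E_PL[Y] = 0.
  rewrite [Y](_ : _ = ((fun w => G w f) \- (fun w => G w g))%R)//.
  by rewrite expectationB// !(bridge_mean bG) sube0.
have VY : 'V_PL[Y] = 'V_P0[(\val f \- \val g)%R].
  rewrite [Y](_ : _ = ((fun w => G w f) \- (fun w => G w g))%R)//.
  by rewrite !varianceB ?bridge_Lfun2// /variance !bridge_covarianceE.
have := chebyshev Ym e0; rewrite /= EY /=.
under eq_set do rewrite subr0.
move=> /le_trans; apply; rewrite EFinM lee_pmul2l ?lte_fin ?invr_gt0 ?exprn_gt0// VY.
have Lfg : (\val f \- \val g)%R \in Lfun P0 2%:E by rewrite rpredB ?lee1n.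
rewrite varianceE//.
have L1fg : (\val f \- \val g)%R \in Lfun P0 1.
  have fin0 : P0 [set: X] \is a fin_num by rewrite probability_setT.
  exact: Lfun_subset12 fin0 _ Lfg.
apply: (@le_trans _ _ ('E_P0[((\val f \- \val g) ^+ 2)%R])).
  rewrite leeBlDr ?fin_numX ?expectation_fin_num//.
  by rewrite leeDl// sqre_ge0.
have -> : 'E_P0[((\val f \- \val g) ^+ 2)%R] =
    Lnorm P0 2%:E (EFin \o (\val f \- \val g)%R) `^ 2.
  rewrite powR_Lnorm ?pnatr_eq0// unlock; apply: eq_integral => x _.
  by rewrite /= powR_mulrn// real_normK ?num_real.
move: fgr (Lnorm_ge0 P0 2%:E (EFin \o (\val f \- \val g)%R)).
case: (Lnorm _ _ _) => [s|//|//]; rewrite !lee_fin => sr s0.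
by rewrite powR_mulrn// lerXn2r// nnegrE (le_trans s0).
Qed.
End bridge_moments.

(** * Equicontinuity of the Brownian bridge *)

Section oscillation.
Context (R : realType) (I : Type) (A : set I) (i0 : I).
Hypothesis Ai0 : A i0.
Implicit Types z : linfty R I.

Definition oscillation (z : linfty R I) : R := sup [set `|(z i : R) - z i0| | i in A].

Lemma oscillation_has_sup z : has_sup [set `|(z i : R) - z i0| | i in A].
Proof.
split; first by exists `|z i0 - z i0|; exists i0.
exists (`|z| + `|z|) => _ [i _ <-].
by rewrite (le_trans (ler_normB _ _))// lerD//; exact: supnorm_ge.
Qed.

Lemma oscillation_ge z i : A i -> `|z i - z i0| <= oscillation z.
Proof.
move=> Ai; apply: ub_le_sup; last by exists i.
by have [] := oscillation_has_sup z.
Qed.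

Lemma oscillation_le z (e : R) : (forall i, A i -> `|z i - z i0| <= e) ->
  oscillation z <= e.
Proof.
move=> ze; apply: ge_sup; first by have [] := oscillation_has_sup z.
by move=> _ [i Ai <-]; exact: ze.
Qed.

(** This is why the oscillation bound for the limit process passes to the
    processes converging to it. *)
Lemma oscillation_lipschitz z z' :
  `|oscillation z - oscillation z'| <= 2 * `|z - z'|.
Proof.
have le y y' : oscillation y <= oscillation y' + 2 * `|y - y'|.
  apply: oscillation_le => i Ai.
  have := oscillation_ge y' Ai.
  have := linfty_dist_ge y y' i; have := linfty_dist_ge y y' i0.
  rewrite !ler_norml => /andP[a1 a2] /andP[b1 b2] /andP[c1 c2].
  apply/andP; split; lra.
rewrite ler_norml; apply/andP; split; have := le z z'; have := le z' z;
  rewrite (distrC z'); lra.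
Qed.

End oscillation.

Section equicontinuity.
Local Open Scope ereal_scope.
Context (R : realType) (dX : measure_display) (X : measurableType dX).
Variables (P0 : probability X R) (F : set (X -> R)).
Context (dL : measure_display) (OmL : measurableType dL).
Variables (PL : probability OmL R) (G : OmL -> linfty R F).
Hypothesis bG : brownian_bridge P0 PL G.
Variable phi0 : F.

Definition L2_ball (delta : R) : set F :=
  [set f | Lnorm P0 2%:E (EFin \o (\val f \- \val phi0)%R) < delta%:E].

Lemma L2_ball_center (delta : R) : (0 < delta)%R -> L2_ball delta phi0.
Proof.
move=> d0; rewrite /L2_ball /=.
rewrite (_ : EFin \o _ = cst 0); last by apply/funext => x /=; rewrite subrr.
by rewrite Lnorm0// lte_fin.
Qed.

(** Outside [A] the path lies in a compact set [K] and has small increments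
    between [phi0] and one representative of each cell; the other increments
    are controlled by the coloring. The exceptional set [A] absorbs [eta / 2]
    for [K] and [eta / 2] for the representatives. *)
Lemma bridge_small_oscillation (e eta : R) : (0 < e)%R -> (0 < eta)%R ->
  exists2 delta : R, (0 < delta)%R &
  exists2 A : set OmL, measurable A /\ PL A <= eta%:E &
    forall w, ~ A w -> (oscillation (L2_ball delta) phi0 (G w) <= e)%R.
Proof.
move=> e0 eta0; have e40 : (0 < e / 4)%R by rewrite divr_gt0.
have eta20 : (0 < eta / 2)%R by rewrite divr_gt0.
have [K cK KP] := bridge_tight bG eta20.
have [s sP] := compact_net cK e40.
have [N [c cP]] := finite_coloring s e40.
pose delta := Num.sqrt ((e / 4) ^+ 2 * (eta / 2) / N.+1%:R)%R.
have delta0 : (0 < delta)%R.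
  by rewrite sqrtr_gt0 divr_gt0// mulr_gt0// exprn_gt0.
have /choice[rep repP] : forall t : nat, exists g : F, L2_ball delta g /\
    forall f, L2_ball delta f -> val (c f) = t -> val (c g) = t.
  move=> t.
  have [[g [gd gt]]|no] := pselect (exists g, L2_ball delta g /\ val (c g) = t).
    by exists g.
  (* A cell that misses the ball gets the center as its representative. *)
  exists phi0; split; first exact: L2_ball_center.
  by move=> f fd ft; exfalso; apply: no; exists f.
pose B t := [set w | (e / 4 <= `|G w (rep t) - G w phi0|)%R].
have mB t : measurable (B t).
  have mdist : measurable_fun setT (fun w => `|G w (rep t) - G w phi0|%R : R).
    apply: measurableT_comp => //.
    by apply: measurable_funB; exact: (bridge_coordinate_measurable bG).
  have := mdist measurableT `[(e / 4)%R, +oo[%classic (measurable_itv _).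
  rewrite setTI; congr measurable; apply/seteqP; split => w /=;
    by rewrite in_itv /= andbT.
have mK : measurable (G @^-1` K).
  have oK : open (~` K).
    by apply: closed_openC; apply: compact_closed => //; exact: norm_hausdorff.
  rewrite -[K]setCK preimage_setC; apply: measurableC.
  have mG := bridge_measurable bG.
  rewrite -[X in measurable X]setTI; apply: (mG measurableT (~` K)).
  exact: sub_sigma_algebra.
exists delta => //.
(* [N] is fixed before [delta], so the [N] Chebyshev bounds
   [(e / 4) ^- 2 * delta ^+ 2] add up to at most [eta / 2]. *)
exists (~` (G @^-1` K) `|` \big[setU/set0]_(t < N) B t).
  have mBN : measurable (\big[setU/set0]_(t < N) B t).
    by apply: bigsetU_measurable.
  split; first by apply: measurableU => //; exact: measurableC.
  apply: le_trans (measureU2 _ _ _) _ => //; first exact: measurableC.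
  rewrite [eta in leRHS](splitr eta) EFinD; apply: leeD.
    rewrite [leLHS](_ : _ = 1 - PL (G @^-1` K)); last exact: probability_setC.
    by rewrite leeBlDr ?fin_num_measure// -leeBlDl// -EFinB.
  apply: le_trans (le_mu_bigsetU _ _) _ => //.
  have bE : ((e / 4) ^- 2 * delta ^+ 2 = eta / 2 / N.+1%:R)%R.
    rewrite sqr_sqrtr; last by rewrite divr_ge0// mulr_ge0 ?exprn_ge0 ?ltW.
    by field; rewrite (gt_eqF e0) andbT lt0r_neq0// ltr_pwDl.
  apply: (@le_trans _ _ (\sum_(t < N) (eta / 2 / N.+1%:R)%:E)).
    apply: lee_sum => t _; rewrite -bE; apply: (bridge_chebyshev bG) => //.
    by have [/ltW] := repP t.
  rewrite sumEFin lee_fin big_const_ord iter_addr addr0 -[leLHS]mulr_natr mulrAC.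
  by rewrite ler_pdivrMr// ler_pM2l// ler_nat.
move=> w /not_orP[/contrapT/= Kw Bw]; apply: oscillation_le => [|f fd].
  exact: L2_ball_center.
have [y ys yw] := sP _ Kw.
have [gd gc] := repP (val (c f)).
have cfg : c f = c (rep (val (c f))) by apply: val_inj; rewrite (gc f)//.
have d1 := linfty_dist_ge y (G w) f.
have d2 := linfty_dist_ge y (G w) (rep (val (c f))).
(* From [f] to its representative along the net point [y], then to [phi0]:
   four increments of size at most [e / 4]. *)
have d3 := cP _ _ cfg _ ys.
have d4 : (`|G w (rep (val (c f))) - G w phi0| < e / 4)%R.
  rewrite ltNge; apply/negP => wB; apply: Bw.
  by rewrite -bigcup_mkord; exists (val (c f)) => //=.
move: yw d1 d2 d3 d4 => /ltW yw /le_trans/(_ yw) + /le_trans/(_ yw) + + /ltW.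
rewrite !ler_norml => /andP[a1 a2] /andP[b1 b2] /andP[c1 c2] /andP[e1 e2].
apply/andP; split; lra.
Qed.

(** Asymptotic equicontinuity at [phi0] as seen by a test function: it detects
    a deviation by [e] over the ball, while its expectation under the limit is
    at most [eta]. *)
Lemma bridge_equicontinuity (e eta : R) : (0 < e)%R -> (0 < eta)%R ->
  exists2 delta : R, (0 < delta)%R &
  exists h : linfty R F -> R, [/\ test_function h, 'E_PL[h \o G] <= eta%:E &
    forall (z : linfty R F) (f : F), L2_ball delta f -> (e <= `|z f - z phi0| -> h z = 1)%R].
Proof.
move=> e0 eta0; have e20 : (0 < e / 2)%R by rewrite divr_gt0.
have [delta d0 [A [mA PA] HA]] := bridge_small_oscillation e20 eta0.
exists delta => //; pose osc (z : linfty R F) := oscillation (L2_ball delta) phi0 z.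
have ball0 := L2_ball_center d0.
exists (fun z => ramp (e / 2) (e / 2) (osc z)).
have th : test_function (fun z => ramp (e / 2) (e / 2) (osc z)).
  split; first by move=> z; exact: ramp_unit_valued.
  exists ((e / 2)^-1 * 2)%R; first by rewrite mulr_gt0// invr_gt0.
  move=> z z'; apply: (le_trans (ramp_lipschitz _ _ _ e20)).
  rewrite -mulrA ler_pM2l ?invr_gt0//; exact: oscillation_lipschitz.
split=> // [|z f fd ezf].
  apply: le_trans PA; apply: test_function_expectation_le => //.
  - exact: (bridge_measurable bG).
  - by move=> w /HA ow; rewrite ramp0.
apply: ramp1 => //; rewrite -splitr; apply: le_trans ezf _.
exact: oscillation_ge.
Qed.

End equicontinuity.

(** * Sandwiching and linearization *)

Section portmanteau.
Local Open Scope ereal_scope.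
Context (R : realType) (D : normedModType R).
Context (d : measure_display) (Om : measurableType d).
Variable P : probability Om R.
Context (dV : nat -> measure_display) (V : forall n, measurableType (dV n)).
Variable QV : forall n, probability (V n) R.
Context (dL : measure_display) (OmL : measurableType dL).
Variables (PL : probability OmL R) (G : OmL -> D).
Hypothesis mG : borel_measurable G.
Variable Z : forall n, Om -> V n -> D.
Hypothesis ZG : cond_cvg_law P QV PL G Z.

(** The event is charged to [C], which vanishes, and to a test function whose
    outer expectation converges to a value as small as desired. *)
Lemma cond_vanishing_test (B : forall n, Om -> set (V n)) :
  (forall eta : R, (0 < eta)%R -> exists h C, [/\ test_function h,
    'E_PL[h \o G] <= eta%:E, cond_vanishing P QV C &
    forall n om, B n om `<=` C n om `|` [set v | h (Z om v) = 1%R]]) ->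
  cond_vanishing P QV B.
Proof.
move=> hyp e e0; have e30 : (0 < e / 3)%R by rewrite divr_gt0.
have [h [C [th hle C0 BC]]] := hyp _ e30.
apply: vanishing_sub (vanishingU (C0 _ e30) (ZG th e30)) => n om /=.
have [h01 _] := th.
have [m _ mE] := test_function_expectation PL mG th.
have [a _ aE] := outer_expectationE (QV n) (fun v => h01 (Z om v)).
have [b /andP[b0 _] bE] := outer_probE (QV n) (B n om).
have [c /andP[c0 _] cE] := outer_probE (QV n) (C n om).
have : outer_prob (QV n) (B n om) <=
    outer_prob (QV n) (C n om) + outer_expectation (QV n) (h \o Z om).
  apply: outer_expectation_leD.
  - exact: indic_unit_valued.
  - by move=> v; exact: h01.
  - by move=> v; have /andP[] := @indic_unit_valued R _ (B n om) v.
  move=> v; have /andP[hv _] := h01 (Z om v).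
  have /andP[cv _] := @indic_unit_valued R _ (C n om) v.
  rewrite /= [in leLHS]indicE; have [/set_mem/BC|_] := boolP (v \in B n om).
    by case=> [/mem_set Cv|/= ->]; rewrite ?indicE ?Cv ?lerDl ?lerDr.
  by rewrite addr_ge0.
move: hle; rewrite bE cE aE mE -EFinD !sube0 /= !lee_fin.
rewrite (ger0_norm b0) (ger0_norm c0) => m3 bca eb.
have [|ce] := lerP (e / 3) c; first by left.
by right; rewrite ler_normr; apply/orP; left; lra.
Qed.

(** Subadditivity yields both bounds without passing to complements: the
    indicator of [E] is at most [h'] plus the indicator of a vanishing event,
    and [h] is at most the indicator of [E] plus such an indicator. *)
Lemma cond_portmanteau (E : forall n, Om -> set (V n)) (L : R) :
  (forall eta : R, (0 < eta)%R -> exists h h', [/\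
    test_function h /\ test_function h',
    (L - eta)%:E <= 'E_PL[h \o G], 'E_PL[h' \o G] <= (L + eta)%:E,
    cond_vanishing P QV (fun n om => [set v | ~ E n om v /\ h (Z om v) <> 0%R]) &
    cond_vanishing P QV (fun n om => [set v | E n om v /\ h' (Z om v) <> 1%R])]) ->
  cvg_outer_prob P (fun n om => outer_prob (QV n) (E n om)) L.
Proof.
move=> hyp e e0; have e30 : (0 < e / 3)%R by rewrite divr_gt0.
have [h [h' [[th th'] hL h'L B0 B'0]]] := hyp _ e30.
apply: vanishing_sub (vanishingU (vanishingU (B0 _ e30) (ZG th e30))
  (vanishingU (B'0 _ e30) (ZG th' e30))) => n om /=.
set B := [set v | _ /\ h _ <> _]; set B' := [set v | _ /\ h' _ <> _].
have [h01 _] := th; have [h'01 _] := th'.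
have [m _ mE] := test_function_expectation PL mG th.
have [m' _ m'E] := test_function_expectation PL mG th'.
have [a _ aE] := outer_expectationE (QV n) (fun v => h01 (Z om v)).
have [a' _ a'E] := outer_expectationE (QV n) (fun v => h'01 (Z om v)).
have [b /andP[b0 _] bE] := outer_probE (QV n) B.
have [b' /andP[b'0 _] b'E] := outer_probE (QV n) B'.
have [p _ pE] := outer_probE (QV n) (E n om).
have ind0 T (A : set T) v : (0 <= \1_A v :> R)%R.
  by have /andP[] := @indic_unit_valued R _ A v.
have : outer_expectation (QV n) (h \o Z om) <=
    outer_prob (QV n) (E n om) + outer_prob (QV n) B.
  apply: outer_expectation_leD; try exact: indic_unit_valued.
    by move=> v; have /andP[] := h01 (Z om v).
  move=> v /=; have /andP[_ hv] := h01 (Z om v).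
  have [Ev|nEv] := pselect (E n om v).
    by rewrite indicE mem_set// (le_trans hv)// lerDl.
  have [->|hv0] := eqVneq (h (Z om v)) 0%R; first by rewrite addr_ge0.
  rewrite [X in (_ <= _ + X)%R]indicE mem_set ?(le_trans hv) ?lerDr//.
  by split => //; exact/eqP.
have : outer_prob (QV n) (E n om) <=
    outer_expectation (QV n) (h' \o Z om) + outer_prob (QV n) B'.
  apply: outer_expectation_leD; last 2 first.
  - by move=> v; exact: ind0.
  - move=> v /=; have /andP[hv _] := h'01 (Z om v).
    have [Ev|nEv] := pselect (E n om v); last first.
      by rewrite indicE memNset// addr_ge0.
    rewrite indicE mem_set//.
    have [->|hv1] := eqVneq (h' (Z om v)) 1%R; first by rewrite lerDl.
    rewrite [X in (_ <= _ + X)%R]indicE mem_set ?lerDr//.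
    by split => //; exact/eqP.
  - by move=> v; exact: h'01.
  - exact: indic_unit_valued.
move: hL h'L; rewrite !sube0 bE b'E aE a'E mE m'E pE -!EFinD /= !lee_fin.
rewrite (ger0_norm b0) (ger0_norm b'0) => h1 h2 h3 h4.
rewrite !ler_normr => epL.
have [|ce] := lerP (e / 3) b; first by left; left.
have [|ce'] := lerP (e / 3) b'; first by right; left.
by case/orP: epL => epL; [right|left]; right; apply/orP; [left|right]; lra.
Qed.

End portmanteau.

Section linearization.
Local Open Scope ereal_scope.
Context (R : realType) (dX : measure_display) (X : measurableType dX).
Variables (P0 : probability X R) (F : set (X -> R)).
Context (d : measure_display) (Om : measurableType d).
Variable P : probability Om R.
Context (dV : nat -> measure_display) (V : forall n, measurableType (dV n)).
Variable QV : forall n, probability (V n) R.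
Context (dL : measure_display) (OmL : measurableType dL).
Variables (PL : probability OmL R) (G : OmL -> linfty R F).
Hypothesis bG : brownian_bridge P0 PL G.
Variable Z : forall n, Om -> V n -> linfty R F.
Hypothesis ZG : cond_cvg_law P QV PL G Z.

(** With probability tending to one [f] lies in the class and in any given L2
    ball around [phi0], where equicontinuity bounds the difference of the
    values of the process at [f] and at [phi0]. *)
Lemma cond_linearization (phi0 : F) (A : forall n, Om -> V n -> (X -> R) -> R)
    (f : forall n, Om -> V n -> X -> R) (S : forall n, Om -> V n -> R) :
  (forall n om v (g : F), Z om v g = A n om v (\val g)) ->
  cond_vanishing P QV (fun n om => [set v | ~ F (f n om v)]) ->
  (forall delta : R, (0 < delta)%R -> cond_vanishing P QV (fun n om =>
    [set v | delta%:E <= Lnorm P0 2%:E (EFin \o (f n om v \- \val phi0)%R)])) ->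
  (forall e : R, (0 < e)%R -> cond_vanishing P QV (fun n om =>
    [set v | (e <= `|S n om v - A n om v (f n om v)|)%R])) ->
  forall e : R, (0 < e)%R -> cond_vanishing P QV (fun n om =>
    [set v | (e <= `|S n om v - Z om v phi0|)%R]).
Proof.
move=> ZA fF f0 SA e e0.
apply: (cond_vanishing_test (bridge_measurable bG) ZG) => r r0.
have e20 : (0 < e / 2)%R by rewrite divr_gt0.
have [delta d0 [h [th hle hosc]]] := bridge_equicontinuity bG phi0 e20 r0.
exists h; eexists; split=> //.
  exact: cond_vanishingU (cond_vanishingU fF (f0 _ d0)) (SA _ e20).
move=> n om v /= eS.
have [Ff|] := pselect (F (f n om v)); last by left; left; left.
have [fd|] := ltP (Lnorm P0 2%:E (EFin \o (f n om v \- \val phi0)%R)) delta%:E;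
  last by left; left; right.
have [Sf|] := ltP `|S n om v - A n om v (f n om v)|%R (e / 2)%R;
  last by left; right.
right; pose g : F := exist _ (f n om v) (mem_set Ff).
apply: (hosc _ g) => //; rewrite (ZA _ _ _ g).
have : (`|S n om v - Z om v phi0| <= `|S n om v - A n om v (f n om v)| +
    `|A n om v (f n om v) - Z om v phi0|)%R.
  exact: ler_distD.
by move: eS Sf; rewrite /g /=; lra.
Qed.

End linearization.

(** * Events determined by an asymptotically normal statistic *)

Section test_function_algebra.
Context (R : realType) (D : normedModType R).
Implicit Types h : D -> R.

Lemma test_functionC h : test_function h -> test_function (fun z => 1 - h z).
Proof.
move=> [h01 [K K0 hK]]; split=> [z|].
  by have := h01 z; lra.
exists K => // z z'; rewrite (_ : _ - _ = h z' - h z); last by ring.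
by rewrite distrC.
Qed.

Lemma test_functionM h h' : test_function h -> test_function h' ->
  test_function (fun z => h z * h' z).
Proof.
move=> [h01 [K K0 hK]] [h'01 [K' K'0 h'K]]; split=> [z|].
  have /andP[a0 a1] := h01 z; have /andP[b0 b1] := h'01 z.
  by rewrite mulr_ge0// mulr_ile1.
exists (K + K') => [|z z']; first by rewrite addr_gt0.
have -> : h z * h' z - h z' * h' z' =
  h z * (h' z - h' z') + (h z - h z') * h' z' by ring.
apply: (le_trans (ler_normD _ _)); rewrite !normrM mulrDl addrC.
have /andP[a0 a1] := h01 z; have /andP[b0 b1] := h'01 z'.
rewrite (ger0_norm a0) (ger0_norm b0); apply: lerD.
  by apply: le_trans (hK z z'); rewrite ler_piMr.
by apply: le_trans (h'K z z'); rewrite ler_piMl.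
Qed.

Lemma test_function_ramp (T : D -> R) (a e : R) : 0 < e ->
  (forall z z', `|T z - T z'| <= `|z - z'|) ->
  test_function (fun z => ramp a e (T z)).
Proof.
move=> e0 TL; split=> [z|]; first exact: ramp_unit_valued.
exists e^-1 => [|z z']; first by rewrite invr_gt0.
apply: (le_trans (ramp_lipschitz _ _ _ e0)).
by rewrite ler_pM2l ?invr_gt0.
Qed.

End test_function_algebra.

Section scalar_portmanteau.
Context (R : realType) (D : normedModType R).
Context (d : measure_display) (Om : measurableType d).
Variable P : probability Om R.
Context (dV : nat -> measure_display) (V : forall n, measurableType (dV n)).
Variable QV : forall n, probability (V n) R.
Context (dL : measure_display) (OmL : measurableType dL).
Variables (PL : probability OmL R) (G : OmL -> D).
Hypothesis mG : borel_measurable G.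
Variable Z : forall n, Om -> V n -> D.
Hypothesis ZG : cond_cvg_law P QV PL G Z.

Variable T : D -> R.
Hypothesis TL : forall z z', `|T z - T z'| <= `|z - z'|.
Variable Phi : R -> R.
Hypothesis PhiE : forall b, PL [set w | T (G w) <= b] = (Phi b)%:E.
Hypothesis Phi_continuous : continuous Phi.

Variable S : forall n, Om -> V n -> R.
Hypothesis SZ : forall e : R, 0 < e ->
  cond_vanishing P QV (fun n om => [set v | e <= `|S om v - T (Z om v)|]).

Let mTG : measurable_fun [set: OmL] (fun w => T (G w)).
Proof.
apply: (measurable_continuous_comp mG (h := T)).
by apply: (@lipschitz_fun_continuous _ _ _ 1) => // z z'; rewrite mul1r.
Qed.

Let mle b : measurable [set w | T (G w) <= b].
Proof.
have := mTG measurableT (measurable_itv `]-oo, b]).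
by rewrite setTI; congr measurable; apply/seteqP; split => w /=; rewrite in_itv.
Qed.

Let mltle a b : measurable [set w | a < T (G w) <= b].
Proof.
have := mTG measurableT (measurable_itv `]a, b]).
by rewrite setTI; congr measurable; apply/seteqP; split => w /=; rewrite in_itv.
Qed.

Let PL_ltle a b : a <= b -> PL [set w | a < T (G w) <= b] = (Phi b - Phi a)%:E.
Proof.
move=> ab; rewrite EFinB -!PhiE.
rewrite (_ : [set w | T (G w) <= b] = [set w | T (G w) <= a] `|` [set w | a < T (G w) <= b]).
  rewrite measureU//; last first.
    by apply/seteqP; split => w //= -[Ta /andP[aT _]]; move: aT; rewrite ltNge Ta.
  by rewrite addeAC subee ?fin_num_measure// add0e.
apply/seteqP; split => w /=; last first.
  by case=> [/le_trans->//|/andP[]].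
by move=> Tb; have [Ta|aT] := leP (T (G w)) a; [left|right; apply/andP].
Qed.

Let Phi_near b eta : 0 < eta -> exists2 e, 0 < e &
  forall x, b - 3 * e <= x -> x <= b + 3 * e ->
    Phi b - eta <= Phi x /\ Phi x <= Phi b + eta.
Proof.
move=> eta0; have /cvgrPdist_le/(_ _ eta0) := @Phi_continuous b.
move=> /nbhs_ballP[r /= r0 rP]; exists (r / 4); first by rewrite divr_gt0.
move=> x bx xb; have /rP : ball b r x.
  by rewrite /ball/= ltr_norml; apply/andP; split; lra.
by rewrite /= ler_norml => /andP[? ?]; split; lra.
Qed.

(** Only one-sided inclusions up to a margin [e] are asked of the events
    [E], so that random thresholds converging to [b] can be treated. The
    ramps are placed at distance [2 e] to [3 e] from [b]: one [e] for this
    margin, one for the distance of [S] to its linearization. *)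
Lemma cond_portmanteau_left (b : R) (E : forall n, Om -> set (V n)) :
  (forall e : R, 0 < e -> cond_vanishing P QV
     (fun n om => [set v | E n om v /\ b + e < S om v])) ->
  (forall e : R, 0 < e -> cond_vanishing P QV
     (fun n om => [set v | ~ E n om v /\ S om v < b - e])) ->
  cvg_outer_prob P (fun n om => outer_prob (QV n) (E n om)) (Phi b).
Proof.
move=> Eup Elo; apply: (cond_portmanteau mG ZG) => eta eta0.
have [e e0 Phie] := Phi_near b eta0.
exists (fun z => 1 - ramp (b - 3 * e) e (T z)).
exists (fun z => 1 - ramp (b + 2 * e) e (T z)).
have th : test_function (fun z => 1 - ramp (b - 3 * e) e (T z)).
  by apply: test_functionC; exact: test_function_ramp.
have th' : test_function (fun z => 1 - ramp (b + 2 * e) e (T z)).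
  by apply: test_functionC; exact: test_function_ramp.
split=> //.
- apply: le_trans (test_function_expectation_ge PL mG th (mle (b - 3 * e)) _).
    by rewrite PhiE lee_fin; have [||//] := Phie (b - 3 * e); lra.
  by move=> w /= Tb; rewrite ramp0 ?subr0.
- apply: le_trans (test_function_expectation_le PL mG th' (mle (b + 3 * e)) _) _.
    move=> w /= /negP; rewrite -ltNge => bT; rewrite ramp1 ?subrr//; lra.
  by rewrite PhiE lee_fin; have [||//] := Phie (b + 3 * e); lra.
- apply: cond_vanishing_sub (cond_vanishingU (Elo _ e0) (SZ e0)) => n om v /=.
  move=> [nE hZ]; have [bS|Sb] := leP (b - e) (S om v); last by left.
  right; rewrite ler_normr; apply/orP; left.
  rewrite leNgt; apply/negP => SZe; apply: hZ; rewrite ramp1 ?subrr//; lra.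
- apply: cond_vanishing_sub (cond_vanishingU (Eup _ e0) (SZ e0)) => n om v /=.
  move=> [Ev hZ]; have [Sb|bS] := leP (S om v) (b + e); last by left.
  right; rewrite ler_normr; apply/orP; right.
  rewrite leNgt; apply/negP => SZe; apply: hZ; rewrite ramp0 ?subr0//; lra.
Qed.

(** The test functions are products of an increasing and a decreasing ramp. *)
Lemma cond_portmanteau_interval (a b : R) (E : forall n, Om -> set (V n)) :
  a < b ->
  (forall e : R, 0 < e -> cond_vanishing P QV
     (fun n om => [set v | E n om v /\ ~ (a - e <= S om v <= b + e)])) ->
  (forall e : R, 0 < e -> cond_vanishing P QV
     (fun n om => [set v | ~ E n om v /\ a + e <= S om v <= b - e])) ->
  cvg_outer_prob P (fun n om => outer_prob (QV n) (E n om)) (Phi b - Phi a).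
Proof.
move=> ab Eup Elo; apply: (cond_portmanteau mG ZG) => eta eta0.
have eta20 : 0 < eta / 2 by rewrite divr_gt0.
have [ea ea0 Phia] := Phi_near a eta20.
have [eb eb0 Phib] := Phi_near b eta20.
pose e := Num.min (Num.min ea eb) ((b - a) / 6).
have e0 : 0 < e by rewrite !lt_min ea0 eb0 divr_gt0// subr_gt0.
have eea : e <= ea by rewrite !ge_min lexx.
have eeb : e <= eb by rewrite !ge_min lexx orbT.
have eab : e <= (b - a) / 6 by rewrite !ge_min lexx orbT.
pose win l r z := ramp l e (T z) * (1 - ramp r e (T z)).
have th l r : test_function (win l r).
  apply: test_functionM; first exact: test_function_ramp.
  by apply: test_functionC; exact: test_function_ramp.
exists (win (a + 2 * e) (b - 3 * e)), (win (a - 3 * e) (b + 2 * e)).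
split.
- by split; exact: th.
- apply: le_trans (test_function_expectation_ge PL mG (th _ _)
      (mltle (a + 3 * e) (b - 3 * e)) _).
    rewrite PL_ltle ?lee_fin; last lra.
    have [||] := Phib (b - 3 * e); have [||] := Phia (a + 3 * e); lra.
  move=> w /= /andP[aT Tb]; rewrite /win ramp1//; last lra.
  by rewrite ramp0// subr0 mulr1.
- apply: le_trans (test_function_expectation_le PL mG (th _ _)
      (mltle (a - 3 * e) (b + 3 * e)) _) _.
    move=> w /= /negP; rewrite negb_and -leNgt -ltNge /win => /orP[Ta|bT].
      by rewrite ramp0// mul0r.
    by rewrite (ramp1 (a := b + 2 * e))// ?subrr ?mulr0//; lra.
  rewrite PL_ltle ?lee_fin; last lra.
  have [||] := Phib (b + 3 * e); have [||] := Phia (a - 3 * e); lra.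
- apply: cond_vanishing_sub (cond_vanishingU (Elo _ e0) (SZ e0)) => n om v /=.
  move=> [nE hZ]; have [abS|Sab] := pselect (a + e <= S om v <= b - e).
    by left.
  right; rewrite leNgt; apply/negP; rewrite ltr_norml => /andP[S1 S2].
  apply: hZ; rewrite /win.
  move: Sab => /negP; rewrite negb_and -!ltNge => /orP[Sa|bS].
    by rewrite ramp0 ?mul0r//; lra.
  by rewrite (ramp1 (a := b - 3 * e))// ?subrr ?mulr0//; lra.
- apply: cond_vanishing_sub (cond_vanishingU (Eup _ e0) (SZ e0)) => n om v /=.
  move=> [Ev hZ]; have [abS|Sab] := pselect (a - e <= S om v <= b + e); last by left.
  right; rewrite leNgt; apply/negP; rewrite ltr_norml => /andP[S1 S2].
  apply: hZ; rewrite /win; move: abS => /andP[aS Sb].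
  by rewrite ramp1 ?ramp0 ?subr0 ?mulr1//; lra.
Qed.

End scalar_portmanteau.

(** * Affine images of the normal law *)

Section affine.
Local Open Scope ereal_scope.
Context (R : realType).
Notation mu := (@lebesgue_measure R).

Definition affine (a b : R) : measurableTypeR R -> measurableTypeR R :=
  fun x => (a * x + b)%R.

Lemma measurable_affine a b :
  measurable_fun [set: measurableTypeR R] (affine a b).
Proof. by apply: measurable_funD => //; exact: measurable_funM. Qed.

HB.instance Definition _ a b := isMeasurableFun.Build _ _ (measurableTypeR R)
  (measurableTypeR R) (affine a b) (measurable_affine a b).

(** Both sides are measures that agree on half-open intervals; for [a < 0] the
    preimage is an interval closed on the other side. *)
Lemma lebesgue_measure_affine (a b : R) (A : set (measurableTypeR R)) :
  (a != 0)%R -> measurable A ->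
  mu A = `|a|%:E * mu (affine a b @^-1` A).
Proof.
move=> a0.
pose F : {mfun measurableTypeR R >-> measurableTypeR R} := affine a b.
pose k : {nonneg R} := NngNum (normr_ge0 a).
have mF : measurable_fun [set: measurableTypeR R] F := measurable_affine a b.
pose nu := mscale k (pushforward mu F).
move=> mA; rewrite -[RHS]/(nu mF A).
apply: (@lebesgue_measure_unique _ (nu mF)) => // _ [[c d] _ <-].
rewrite -[RHS]/(`|a|%:E * mu (affine a b @^-1` `]c, d]%classic)).
rewrite lebesgue_measure_itv/=.
have [a_gt0|a_lt0|/eqP] := ltrgt0P a; last by rewrite (negbTE a0).
- rewrite (_ : affine a b @^-1` _ = `](c - b) / a, (d - b) / a]%classic)%R.
    rewrite lebesgue_measure_itv/= !lte_fin ltr_pM2r ?invr_gt0// ltrD2r.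
    case: ifPn => _; rewrite ?mule0// -!EFinB -EFinM; congr EFin.
    by field; rewrite gt_eqF.
  apply/seteqP; split => x; rewrite /= /affine !in_itv/=;
    rewrite ltr_pdivrMr// ler_pdivlMr// ltrBlDr lerBrDr mulrC//.
- rewrite (_ : affine a b @^-1` _ = `[(d - b) / a, (c - b) / a[%classic)%R.
    rewrite lebesgue_measure_itv/= !lte_fin ltr_nM2r ?invr_lt0// ltrD2r.
    case: ifPn => _; rewrite ?mule0// -!EFinB -EFinM; congr EFin.
    by field; rewrite lt_eqF.
  apply/seteqP; split => x; rewrite /= /affine !in_itv/=;
    rewrite ltr_ndivlMr// ler_ndivrMr// ltrBlDr lerBrDr mulrC andbC//.
Qed.

(** Change of variables for the density. The sign of [a * s] is irrelevant
    since the density depends on the scale through its square, so reflections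
    are covered along with positive scalings. *)
Lemma normal_prob_affine (a b m s : R) (A : set (measurableTypeR R)) :
  (a != 0)%R -> (s != 0)%R -> measurable A ->
  normal_prob m s (affine a b @^-1` A) = normal_prob (a * m + b)%R (a * s)%R A.
Proof.
move=> a0 s0 mA; have as0 : (a * s != 0)%R by rewrite mulf_neq0.
have pdf_ge0 x : 0 <= (normal_pdf (a * m + b) (a * s) x)%:E :> \bar R.
  by rewrite lee_fin normal_pdf_ge0.
have mpdf : measurable_fun [set: measurableTypeR R]
    (fun x => (normal_pdf (a * m + b) (a * s) x)%:E).
  by apply/measurable_EFinP; exact: measurable_normal_pdf.
pose F : {mfun measurableTypeR R >-> measurableTypeR R} := affine a b.
pose k : {nonneg R} := NngNum (normr_ge0 a).
have mF : measurable_fun [set: measurableTypeR R] F := measurable_affine a b.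
pose nu := mscale k (pushforward mu F).
rewrite /normal_prob.
transitivity (\int[nu mF]_(x in A) (normal_pdf (a * m + b) (a * s) x)%:E);
  last first.
  apply/esym/eq_measure_integral => B mB _.
  exact: lebesgue_measure_affine.
rewrite /nu ge0_integral_mscale//=; last exact: measurable_funTS.
rewrite ge0_integral_pushforward//=; last exact: measurable_funTS.
rewrite -ge0_integralZl//=.
- apply: eq_integral => x _; rewrite /= -EFinM; congr EFin.
  rewrite /normal_pdf (negbTE as0) (negbTE s0) mulrA; congr (_ * _)%R.
    rewrite /normal_peak.
    have -> : ((a * s) ^+ 2 * pi *+ 2 = a ^+ 2 * (s ^+ 2 * pi *+ 2) :> R)%R by ring.
    rewrite sqrtrM ?sqr_ge0// sqrtr_sqr.
    by rewrite invfM mulrA mulfV ?mul1r// normr_eq0.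
  rewrite /normal_fun /affine; congr expR; field.
  by rewrite s0 a0.
- by rewrite -[X in measurable X]setTI; exact: mF.
- by apply: measurable_funTS; exact: (measurableT_comp mpdf mF).
Qed.
End affine.

Lemma normal_probN (R : realType) (m s : R) : normal_prob m (- s) = normal_prob m s.
Proof.
apply/funext => A; rewrite /normal_prob; apply: eq_integral => x _.
by rewrite /normal_pdf oppr_eq0 /normal_peak /normal_fun sqrrN.
Qed.

(** * Centered normal laws *)

Section law.
Local Open Scope ereal_scope.
Context (R : realType) (d : measure_display) (T : measurableType d).
Variables (P : {measure set T -> \bar R}) (Y : T -> measurableTypeR R).
Hypothesis mY : measurable_fun [set: T] Y.

Lemma law_integral (nu : {measure set (measurableTypeR R) -> \bar R})
    (g : measurableTypeR R -> \bar R) :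
  (forall A, measurable A -> P (Y @^-1` A) = nu A) ->
  measurable_fun [set: measurableTypeR R] g -> (forall y, 0 <= g y) ->
  \int[P]_w g (Y w) = \int[nu]_y g y.
Proof.
move=> law mg g0.
have := @ge0_integral_pushforward _ _ _ _ R Y mY P setT g measurableT mg
  (fun y _ => g0 y).
rewrite preimage_setT => <-.
by apply: eq_measure_integral => A mA _; exact: law.
Qed.

End law.

Section normal_moments.
Local Open Scope ereal_scope.
Context (R : realType).

(** Squared distances to a point are nonnegative, which allows moments to be
    transferred between laws without integrability conditions. *)
Definition sqr_dist (b : R) (y : measurableTypeR R) : \bar R :=
  ((b - y) ^+ 2)%R%:E.

Lemma measurable_sqr_dist b : measurable_fun [set: measurableTypeR R] (sqr_dist b).
Proof.
apply/measurable_EFinP; apply: measurable_funX.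
exact: measurable_funB.
Qed.

Lemma sqr_dist_ge0 b y : 0 <= sqr_dist b y.
Proof. by rewrite lee_fin sqr_ge0. Qed.

Lemma normal_prob_reflection (m s b : R) : (s != 0)%R ->
  \int[normal_prob m s]_y sqr_dist b y =
  \int[normal_prob m s]_y sqr_dist (2 * m - b) y.
Proof.
move=> s0; have N0 : (-1 != 0 :> R)%R by rewrite oppr_eq0 oner_eq0.
rewrite -(@law_integral _ _ _ (normal_prob m s) (affine (-1) (2 * m)))//.
- apply: eq_integral => y _; rewrite /sqr_dist /affine; congr EFin.
  by ring.
- move=> A mA; apply: (etrans (normal_prob_affine (2 * m) m N0 s0 mA)).
  have -> : (-1 * m + 2 * m = m)%R by ring.
  by rewrite mulN1r normal_probN.
- exact: measurable_sqr_dist.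
- exact: sqr_dist_ge0.
Qed.

Lemma normal_prob_scaling (s : R) : (s != 0)%R ->
  \int[normal_prob 0 s]_y sqr_dist 0 y =
  (s ^+ 2)%:E * \int[normal_prob 0 1]_y sqr_dist 0 y.
Proof.
move=> s0.
have s20 : 0 <= (s ^+ 2)%:E :> \bar R by rewrite lee_fin sqr_ge0.
have <- := ge0_integralZl (normal_prob 0 1) measurableT (measurable_sqr_dist 0)
  (fun y _ => sqr_dist_ge0 0 y) s20.
have law (A : set (measurableTypeR R)) : measurable A ->
    normal_prob 0 1 (affine s 0 @^-1` A) = normal_prob 0 s A.
  move=> mA; rewrite (normal_prob_affine 0 0 s0 (oner_neq0 R) mA).
  by rewrite mulr0 addr0 mulr1.
have := law_integral (measurable_affine s 0) law (measurable_sqr_dist 0)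
  (sqr_dist_ge0 0).
move=> <-; apply: eq_integral => y _; rewrite /sqr_dist /affine -EFinM.
by congr EFin; ring.
Qed.

Context (d : measure_display) (T : measurableType d) (P : probability T R).
Variable Y : T -> R.
Hypothesis Y2 : Y \in Lfun P 2%:E.
Hypothesis EY : 'E_P[Y] = 0.
Variable v : R.
Hypothesis v_gt0 : (0 < v)%R.
Hypothesis VY : 'V_P[Y] = v%:E.

Let finP : P [set: T] \is a fin_num.
Proof. by rewrite probability_setT. Qed.

Lemma centered_sqr_dist (b : R) : \int[P]_w sqr_dist b (Y w) = (v + b ^+ 2)%:E.
Proof.
have Y1 : Y \in Lfun P 1 := Lfun_subset12 finP Y2.
have W2 : (cst b \- Y)%R \in Lfun P 2%:E.
  by rewrite rpredB//= ?lee1n// ?Lfun_cst.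
have EW : 'E_P[(cst b \- Y)%R] = b%:E.
  by rewrite expectationB// ?Lfun_cst// expectation_cst EY sube0.
have := varianceB_cst_l b Y2; rewrite varianceE// EW VY => E.
have -> : \int[P]_w sqr_dist b (Y w) = 'E_P[((cst b \- Y) ^+ 2)%R].
  by rewrite unlock; apply: eq_integral.
move: E; case: ('E_P[_]) => [r|//|//].
by rewrite -EFin_expe -EFinB => -[<-]; rewrite subrK.
Qed.

(** The mean parameter [m] vanishes by symmetry: reflecting at [m] exchanges
    the points 0 and [2 * m], while the second moment about [b] of a centered
    variable is [v + b ^+ 2]. The scale is then determined up to sign by [v]
    and by the second moment of the standard normal law. A degenerate law is
    excluded because its second moment about [m] is 0. *)
Lemma centered_normal : normal_law P Y ->
  exists s : R, [/\ (s != 0)%R,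
    forall A : set (measurableTypeR R), measurable A ->
      P (Y @^-1` A) = normal_prob 0 s A &
    v%:E = (s ^+ 2)%:E * \int[normal_prob 0 1]_y sqr_dist 0 y].
Proof.
have mY : measurable_fun [set: T] (Y : T -> measurableTypeR R).
  by have := sub_Lfun_mfun Y2; rewrite inE.
move=> [m [s law]].
have [s0|s0] := eqVneq s 0%R.
  have law' (A : set (measurableTypeR R)) : measurable A -> P (Y @^-1` A) = \d_m A.
    by move=> /law; rewrite s0 eqxx.
  have := centered_sqr_dist m.
  rewrite (law_integral (nu := dirac (m : measurableTypeR R)) mY law'
    (measurable_sqr_dist m) (sqr_dist_ge0 m)).
  rewrite integral_dirac//; last exact: measurable_sqr_dist.
  rewrite diracT mul1e /sqr_dist subrr expr0n => -[] /eqP.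
  by rewrite eq_sym paddr_eq0 ?sqr_ge0 ?ltW// gt_eqF.
have law' (A : set (measurableTypeR R)) : measurable A ->
    P (Y @^-1` A) = normal_prob m s A.
  by move=> /law; rewrite (negbTE s0).
have m0 : m = 0%R.
  have := centered_sqr_dist (2 * m).
  rewrite (law_integral (nu := normal_prob m s) mY law' (measurable_sqr_dist _) (sqr_dist_ge0 _)).
  rewrite normal_prob_reflection// subrr.
  rewrite -(law_integral (nu := normal_prob m s) mY law' (measurable_sqr_dist _) (sqr_dist_ge0 _)).
  rewrite centered_sqr_dist => -[] /addrI /eqP.
  by rewrite expr0n eq_sym sqrf_eq0 mulf_eq0 pnatr_eq0/= => /eqP.
exists s; split=> //; first by rewrite -m0.
rewrite -normal_prob_scaling//.
have := centered_sqr_dist 0; rewrite expr0n addr0 => <-.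
rewrite m0 in law'.
exact: (law_integral (nu := normal_prob 0 s) mY law' (measurable_sqr_dist _) (sqr_dist_ge0 _)).
Qed.

End normal_moments.

(** * The normal distribution function *)

Section normal_cdf.
Context (R : realType).
Variable s : R.
Hypothesis s0 : s != 0.
Notation mu := (@lebesgue_measure R).

Definition normal_cdf (b : R) : R := fine (normal_prob 0 s `]-oo, b]%classic).

Lemma normal_cdfE b : (normal_prob 0 s `]-oo, b]%classic = (normal_cdf b)%:E)%E.
Proof. by rewrite fineK// fin_num_measure. Qed.

Lemma normal_cdf_itv a b : a <= b ->
  (normal_prob 0 s `]a, b]%classic = (normal_cdf b - normal_cdf a)%:E)%E.
Proof.
move=> ab; rewrite EFinB -!normal_cdfE.
have -> : `]-oo, b]%classic = (`]-oo, a] `|` `]a, b])%classic :> set R.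
  by rewrite -itv_bndbnd_setU// bnd_simp.
have -> : (normal_prob 0 s (`]-oo, a] `|` `]a, b])%classic =
    normal_prob 0 s `]-oo, a]%classic + normal_prob 0 s `]a, b]%classic)%E.
  apply: measureU => //; apply/seteqP; split => x //= -[].
  by rewrite !in_itv/= => xa /andP[]; rewrite ltNge xa.
by rewrite addeAC subee ?fin_num_measure// add0e.
Qed.

Let pdf_itv_le a b c : a <= b -> (forall x, normal_pdf 0 s x <= c) ->
  normal_cdf b - normal_cdf a <= c * (b - a).
Proof.
move=> ab pc; rewrite -lee_fin -normal_cdf_itv// /normal_prob.
have muab : mu `]a, b]%classic = (b - a)%:E.
  rewrite lebesgue_measure_itv/= lte_fin; case: ltP => // ba.
  by rewrite (@le_anti _ _ a b) ?ab// subrr.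
apply: (@le_trans _ _ (\int[mu]_(x in `]a, b]%classic) c%:E)%E); last first.
  by rewrite integral_cst// EFinM -muab.
apply: ge0_le_integral => //.
- by move=> x _; rewrite lee_fin normal_pdf_ge0.
- by apply/measurable_EFinP; apply: measurable_funTS; exact: measurable_normal_pdf.
- by move=> x _; rewrite lee_fin.
Qed.

Let pdf_itv_ge a b c : a <= b -> 0 <= c ->
  (forall x, x \in `[a, b] -> c <= normal_pdf 0 s x) ->
  c * (b - a) <= normal_cdf b - normal_cdf a.
Proof.
move=> ab c0 cp; rewrite -lee_fin -normal_cdf_itv// /normal_prob.
have muab : mu `]a, b]%classic = (b - a)%:E.
  rewrite lebesgue_measure_itv/= lte_fin; case: ltP => // ba.
  by rewrite (@le_anti _ _ a b) ?ab// subrr.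
apply: (@le_trans _ _ (\int[mu]_(x in `]a, b]%classic) c%:E)%E).
  by rewrite integral_cst// EFinM -muab.
apply: ge0_le_integral => //.
- by apply/measurable_EFinP; apply: measurable_funTS; exact: measurable_normal_pdf.
- move=> x /=; rewrite in_itv/= => /andP[ax xb]; rewrite lee_fin cp//.
  by rewrite in_itv/= xb ltW.
Qed.

(** The density is bounded by its peak, so that the distribution function is
    Lipschitz. *)
Lemma normal_cdf_continuous : continuous normal_cdf.
Proof.
have lip x y : x <= y ->
    `|normal_cdf y - normal_cdf x| <= normal_peak s * (y - x).
  move=> xy; rewrite ger0_norm; last first.
    by rewrite -(mul0r (y - x)) pdf_itv_ge// => z _; exact: normal_pdf_ge0.
  by apply: pdf_itv_le => // z; exact: normal_pdf_ub.
apply: (@lipschitz_fun_continuous R R^o normal_cdf (normal_peak s)).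
  exact: normal_peak_gt0.
move=> x y; have /orP[xy|yx] := le_total x y.
  by rewrite distrC (distrC x) (ger0_norm (_ : 0 <= y - x)) ?subr_ge0// lip.
by rewrite (ger0_norm (_ : 0 <= x - y)) ?subr_ge0// lip.
Qed.

(** On a compact interval the density is bounded away from 0. *)
Lemma normal_cdf_increasing a b : a < b -> normal_cdf a < normal_cdf b.
Proof.
move=> ab.
have cpdf : {within `[a, b], continuous (normal_pdf 0 s)}.
  by apply: continuous_subspaceT => x; exact: continuous_normal_pdf.
have [c _ cP] := EVT_min (ltW ab) cpdf.
have pdf_gt0 : 0 < normal_pdf 0 s c.
  by rewrite normal_pdfE// mulr_gt0 ?normal_peak_gt0// expR_gt0.
rewrite -subr_gt0; apply: lt_le_trans (pdf_itv_ge (ltW ab) (ltW pdf_gt0) cP).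
by rewrite mulr_gt0// subr_gt0.
Qed.

Let id_measurableTypeR : measurableTypeR R -> R := idfun.

HB.instance Definition _ := @isMeasurableFun.Build _ _ _ _ id_measurableTypeR
  (@measurable_id _ _ setT).

Lemma normal_quantile (p : R) : 0 < p < 1 -> exists x, normal_cdf x = p.
Proof.
move=> /andP[p0 p1].
pose X : {RV (normal_prob 0 s) >-> R} := id_measurableTypeR.
have cdfE : cdf X = EFin \o normal_cdf.
  by apply/funext => r; rewrite /= -normal_cdfE.
have [b pb] : exists b, p < normal_cdf b.
  have := cvg_cdfy1 X; rewrite cdfE.
  move=> /fine_cvgP[_] /cvgrPdist_lt /(_ (1 - p)).
  rewrite subr_gt0 => /(_ p1)[M [_ MP]]; exists (M + 1).
  have /= := MP (M + 1); rewrite ltrDl => /(_ ltr01).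
  by rewrite ltr_norml => /andP[_]; lra.
have [a pa] : exists a, normal_cdf a < p.
  have := cvg_cdfNy0 X; rewrite cdfE.
  move=> /fine_cvgP[_] /cvgrPdist_lt /(_ _ p0)[M [_ MP]]; exists (M - 1).
  have /= := MP (M - 1); rewrite gtrBl => /(_ ltr01).
  by rewrite ltr_norml => /andP[+ _]; lra.
have ab : a <= b.
  rewrite leNgt; apply/negP => /normal_cdf_increasing.
  by move=> /(lt_trans pb)/(lt_trans pa); rewrite ltxx.
have [||c _ <-] := @IVT R normal_cdf a b p ab; last by exists c.
  by apply: continuous_subspaceT => x; exact: normal_cdf_continuous.
by rewrite ge_min le_max (ltW pa) (ltW pb) orbT.
Qed.

End normal_cdf.

(** * Bootstrap quantiles and coverage *)

Lemma mul_near (R : realType) (y t e : R) : 0 < e ->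
  exists2 delta, 0 < delta & forall y' t', `|y' - y| <= delta ->
    `|t' - t| <= delta -> `|y' * t' - y * t| <= e.
Proof.
move=> e0; pose c := `|y| + `|t| + 1.
have c0 : 0 < c by rewrite ltr_wpDl// addr_ge0.
exists (Num.min 1 (e / c)) => [|y' t']; first by rewrite lt_min ltr01 divr_gt0.
set delta := Num.min _ _ => yy' tt'.
have delta1 : delta <= 1 by rewrite ge_min lexx.
have delta0 : 0 <= delta by rewrite (le_trans _ yy').
have t'le : `|t'| <= `|t| + 1.
  rewrite -[t'](subrK t) addrC (le_trans (ler_normD _ _))// lerD2l.
  exact: le_trans tt' delta1.
have -> : y' * t' - y * t = (y' - y) * t' + y * (t' - t) by ring.
apply: (le_trans (ler_normD _ _)); rewrite !normrM.
apply: (@le_trans _ _ (delta * c)); last first.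
  by rewrite -ler_pdivlMr// ge_min lexx orbT.
have := ler_pM (normr_ge0 _) (normr_ge0 _) yy' t'le.
have := ler_wpM2l (normr_ge0 y) tt'.
rewrite /c; lra.
Qed.

Section coverage.
Context (R : realType) (d : measure_display) (Om : measurableType d).
Variable P : probability Om R.
Context (dV : nat -> measure_display) (V : forall n, measurableType (dV n)).
Variable QV : forall n, probability (V n) R.

Variable Phi : R -> R.
Hypothesis Phi_increasing : forall a b, a < b -> Phi a < Phi b.
Hypothesis Phi_quantile : forall p : R, 0 < p < 1 -> exists x, Phi x = p.

Variables (r : nat -> R) (psi0 : R) (psi_n psi_hat : nat -> Om -> R).
Variable psi_star : forall n, Om -> V n -> R.
Hypothesis r_gt0 : forall n, 0 < r n.

Let root n om := r n * (psi_n n om - psi0).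
Let root_star n om (v : V n) := r n * (psi_star om v - psi_hat n om).

(** The limit law [Phi] of each root enters only through these two
    consequences, in which the events [E] may have random boundaries. *)
Hypothesis root_law : forall (a b : R) (E : nat -> set Om), a < b ->
  (forall e : R, 0 < e ->
    vanishing P (fun n => [set om | E n om /\ ~ (a - e <= root n om <= b + e)])) ->
  (forall e : R, 0 < e ->
    vanishing P (fun n => [set om | ~ E n om /\ a + e <= root n om <= b - e])) ->
  outer_prob P (E n) @[n --> \oo] --> (Phi b - Phi a)%:E.

Hypothesis root_star_law : forall (b : R) (E : forall n, Om -> set (V n)),
  (forall e : R, 0 < e -> cond_vanishing P QV
     (fun n om => [set v | E n om v /\ b + e < root_star om v])) ->
  (forall e : R, 0 < e -> cond_vanishing P QV
     (fun n om => [set v | ~ E n om v /\ root_star om v < b - e])) ->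
  cvg_outer_prob P (fun n om => outer_prob (QV n) (E n om)) (Phi b).

Variables (s : nat -> Om -> R) (s_star : forall n, Om -> V n -> R) (s0 : R).
Hypothesis s0_gt0 : 0 < s0.
Hypothesis s_s0 : forall e : R, 0 < e ->
  vanishing P (fun n => [set om | e <= `|s n om - s0|]).
Hypothesis s_star_s0 : forall e : R, 0 < e -> cond_vanishing P QV
  (fun n om => [set v | e <= `|s_star om v - s0|]).

Let stat n om (v : V n) := (psi_star om v - psi_hat n om) / s_star om v.

Let stat_le n om (v : V n) xi : 0 < s_star om v ->
  (stat om v <= xi / r n) = (root_star om v <= xi * s_star om v).
Proof.
move=> s_gt0; rewrite /stat /root_star ler_pdivrMr// mulrAC ler_pdivlMr//.
by rewrite mulrC.
Qed.

(** As soon as the scale is positive, the studentized root is at most [xi]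
    when the root is at most [xi * s_star], a bound close to [xi * s0]. *)
Lemma studentized_root_law (xi : R) :
  cvg_outer_prob P (fun n om =>
    outer_prob (QV n) [set v | stat om v <= xi / r n]) (Phi (xi * s0)).
Proof.
apply: root_star_law => e e0; have [delta d0 mulP] := mul_near xi s0 e0;
  have m0 : 0 < Num.min delta s0 by rewrite lt_min d0.
- apply: cond_vanishing_sub (s_star_s0 m0) => n om v /= [E Sb].
  rewrite leNgt; apply/negP; rewrite lt_min => /andP[sd].
  rewrite ltr_norml => /andP[s_gt _]; have s_gt0 : 0 < s_star om v by lra.
  have := mulP xi (s_star om v); rewrite subrr normr0 => /(_ (ltW d0) (ltW sd)).
  by move: E; rewrite stat_le// ler_norml => E /andP[_]; lra.
- apply: cond_vanishing_sub (s_star_s0 m0) => n om v /= [E Sb].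
  rewrite leNgt; apply/negP; rewrite lt_min => /andP[sd].
  rewrite ltr_norml => /andP[s_gt _]; have s_gt0 : 0 < s_star om v by lra.
  have := mulP xi (s_star om v); rewrite subrr normr0 => /(_ (ltW d0) (ltW sd)).
  move: E => /negP; rewrite stat_le// -ltNge ler_norml => E /andP[+ _]; lra.
Qed.

(** The limit is strictly increasing, hence the conditional distribution
    function is below [p] at [y - e] and above [p] at [y + e] once it is close
    to its limit at these two points; being monotone, it has its quantile in
    between, and in particular the quantile is finite. *)
Lemma boot_quantile_cvg (p y : R) : Phi (y * s0) = p -> forall e : R, 0 < e ->
  vanishing P (fun n => [set om | ~ exists2 x, `|x - y| <= e &
    boot_quantile (QV n) (@stat n om) p = (x / r n)%:E]).
Proof.
move=> yp e e0.
have lo : 0 < p - Phi ((y - e) * s0).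
  by rewrite subr_gt0 -yp Phi_increasing// ltr_pM2r// gtrBl.
have hi : 0 < Phi ((y + e) * s0) - p.
  by rewrite subr_gt0 -yp Phi_increasing// ltr_pM2r// ltrDl.
apply: vanishing_sub (vanishingU (@studentized_root_law (y - e) _ lo)
  (@studentized_root_law (y + e) _ hi)) => n om /=.
apply: contra_notP => /not_orP[/negP + /negP]; rewrite -!ltNge.
have [flo _ floE] := outer_probE (QV n) [set v | stat om v <= (y - e) / r n].
have [fhi _ fhiE] := outer_probE (QV n) [set v | stat om v <= (y + e) / r n].
rewrite floE fhiE /= !lte_fin !ltr_norml => /andP[_ lop] /andP[hip _].
have : (boot_quantile (QV n) (@stat n om) p <= ((y + e) / r n)%:E)%E.
  apply: ge_ereal_inf; exists ((y + e) / r n)%:E => //.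
  by exists ((y + e) / r n) => //=; rewrite fhiE lee_fin; lra.
have : (((y - e) / r n)%:E <= boot_quantile (QV n) (@stat n om) p)%E.
  apply: le_ereal_inf_tmp => _ [xi /= pxi <-]; rewrite lee_fin leNgt.
  apply/negP => xilt; move: pxi; apply/negP; rewrite -ltNge.
  apply: (@le_lt_trans _ _ flo%:E); last by rewrite lte_fin; lra.
  by rewrite -floE; apply: outer_prob_le => v /= /le_trans; apply; exact: ltW.
case: (boot_quantile _ _ _) => [q|//|//]; rewrite !lee_fin.
rewrite ler_pdivrMr// ler_pdivlMr// => qlo qhi.
exists (q * r n); last by rewrite mulfK ?gt_eqF.
by rewrite ler_norml; apply/andP; split; lra.
Qed.

Let boot_intervalE n om (alpha beta x1 x2 : R) :
  boot_quantile (QV n) (@stat n om) (1 - alpha) = (x1 / r n)%:E ->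
  boot_quantile (QV n) (@stat n om) beta = (x2 / r n)%:E ->
  boot_interval (QV n) (psi_n n om) (s n om) (@stat n om) alpha beta psi0 <->
  x2 * s n om <= root n om <= x1 * s n om.
Proof.
move=> q1 q2; rewrite /boot_interval /= q1 q2 -!EFinM -!EFinB !lee_fin /root.
have scale x : x / r n * s n om = (x * s n om) / r n by rewrite mulrAC.
rewrite !scale lerBlDr -lerBlDl ler_pdivlMr// (mulrC (r n)).
by rewrite lerBrDr -lerBrDl ler_pdivrMr// andbC.
Qed.

Lemma boot_interval_level (alpha beta : R) :
  0 < alpha < 1 -> 0 < beta < 1 -> alpha + beta < 1 ->
  asymptotic_level P (fun n om =>
    boot_interval (QV n) (psi_n n om) (s n om) (@stat n om) alpha beta)
    psi0 (1 - alpha - beta).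
Proof.
move=> /andP[alpha0 alpha1] beta01 ab1.
have alpha01' : 0 < 1 - alpha < 1 by lra.
have [z1 z1P] := Phi_quantile alpha01'; have [z2 z2P] := Phi_quantile beta01.
pose y1 := z1 / s0; pose y2 := z2 / s0.
have y1E : y1 * s0 = z1 by rewrite /y1 divfK// gt_eqF.
have y2E : y2 * s0 = z2 by rewrite /y2 divfK// gt_eqF.
have y1P : Phi (y1 * s0) = 1 - alpha by rewrite y1E.
have y2P : Phi (y2 * s0) = beta by rewrite y2E.
have z21 : z2 < z1.
  rewrite ltNge; apply/negP; rewrite le_eqVlt => /orP[/eqP z12|/Phi_increasing].
    by move: z1P; rewrite z12 z2P; lra.
  by rewrite z1P z2P; lra.
rewrite /asymptotic_level.
have <- : Phi z1 - Phi z2 = 1 - alpha - beta by rewrite z1P z2P.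
apply: root_law => // e e0;
  have [d1 d10 mul1] := mul_near y1 s0 e0;
  have [d2 d20 mul2] := mul_near y2 s0 e0;
  have bad := vanishingU (vanishingU (boot_quantile_cvg y1P d10)
    (boot_quantile_cvg y2P d20)) (vanishingU (s_s0 d10) (s_s0 d20));
  apply: vanishing_sub bad => n om /= [CI inside];
  apply: contrapT => /not_orP[/not_orP[/contrapT[x1 x1y q1] /contrapT[x2 x2y q2]]];
  move=> /not_orP[/negP + /negP]; rewrite -!ltNge => /ltW/(mul1 _ _ x1y) + /ltW;
  move=> + /(mul2 _ _ x2y); rewrite y1E y2E !ler_norml => /andP[? ?] /andP[? ?].
- apply: inside; have /andP[? ?] := (boot_intervalE q1 q2).1 CI.
  by apply/andP; split; lra.
- apply: CI; apply/(boot_intervalE q1 q2); move/andP : inside => [? ?].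
  by apply/andP; split; lra.
Qed.

End coverage.

(** * The percentile intervals *)

Section modes.
Local Open Scope ereal_scope.
Context (R : realType) (d : measure_display) (Om : measurableType d).
Variable P : probability Om R.

Lemma vanishing_inner_prob (A : nat -> set Om) :
  inner_prob P (A n) @[n --> \oo] --> 1 -> vanishing P (fun n => ~` A n).
Proof.
move=> A1; rewrite /vanishing.
have -> : (fun n => outer_prob P (~` A n)) = fun n => 1 - inner_prob P (A n).
  apply/funext => n; rewrite /inner_prob.
  have [a _ ->] := outer_probE P (~` A n).
  by rewrite -!EFinB; congr EFin; ring.
by rewrite -(subee (x := 1))//; apply: cvgeB => //; exact: cvg_cst.
Qed.

(** For [s] nonnegative, [s0 * `|s - s0|] is at most [`|s ^+ 2 - s0 ^+ 2|]. *)
Lemma vanishing_sqr (s : nat -> Om -> R) (s0 : R) : (0 < s0)%R ->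
  (forall n om, 0 <= s n om)%R ->
  cvg_outer_prob P (fun n om => ((s n om) ^+ 2)%:E) (s0 ^+ 2)%R ->
  forall e : R, (0 < e)%R ->
    vanishing P (fun n => [set om | (e <= `|s n om - s0|)%R]).
Proof.
move=> s00 sge0 ss e e0; have es00 : (0 < e * s0)%R by rewrite mulr_gt0.
apply: vanishing_sub (ss _ es00) => n om /= es; rewrite lee_fin subr_sqr normrM.
by rewrite ler_pM ?(ltW e0) ?(ltW s00)// ger0_norm ?addr_ge0 ?(ltW s00)// lerDr.
Qed.

Context (dV : nat -> measure_display) (V : forall n, measurableType (dV n)).
Variable QV : forall n, probability (V n) R.

Lemma cond_vanishing_inner_prob (A : forall n, Om -> set (V n)) :
  cvg_outer_prob P (fun n om => inner_prob (QV n) (A n om)) 1 ->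
  cond_vanishing P QV (fun n om => ~` A n om).
Proof.
move=> A1 e e0; apply: vanishing_sub (A1 _ e0) => n om /=; rewrite /inner_prob.
have [a _ ->] := outer_probE (QV n) (~` A n om).
rewrite sube0 -!EFinB /= -normrN.
by rewrite (_ : 1 - a - 1 = - a)%R//; ring.
Qed.

Lemma cond_vanishing_sqr (s : forall n, Om -> V n -> R) (s0 : R) : (0 < s0)%R ->
  (forall n om v, 0 <= s n om v)%R ->
  cond_littleo_outer P QV (fun n om v => ((s n om v) ^+ 2 - s0 ^+ 2)%R%:E)
    (fun=> 1%R) ->
  forall e : R, (0 < e)%R ->
    cond_vanishing P QV (fun n om => [set v | (e <= `|s n om v - s0|)%R]).
Proof.
move=> s00 sge0 ss e e0; have es00 : (0 < e * s0)%R by rewrite mulr_gt0.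
apply: cond_vanishing_sub (ss _ es00) => n om v /= es.
rewrite invr1 mule1 lee_fin subr_sqr normrM.
by rewrite ler_pM ?(ltW e0) ?(ltW s00)// ger0_norm ?addr_ge0 ?(ltW s00)// lerDr.
Qed.

End modes.

Section bridge_law.
Local Open Scope ereal_scope.
Context (R : realType) (dX : measure_display) (X : measurableType dX).
Variables (P0 : probability X R) (F : set (X -> R)).
Context (dL : measure_display) (OmL : measurableType dL).
Variables (PL : probability OmL R) (G : OmL -> linfty R F).
Hypothesis bG : brownian_bridge P0 PL G.

Lemma bridge_coordinate_law (f : F) (v : R) : (0 < v)%R ->
  (\int[P0]_t \val f t = 0)%R -> (\int[P0]_t (\val f t) ^+ 2 = v)%R ->
  exists s : R, [/\ (s != 0)%R,
    forall b, PL [set w | (G w f <= b)%R] = (normal_cdf s b)%:E &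
    v%:E = (s ^+ 2)%:E * \int[normal_prob 0 1]_y sqr_dist 0 y].
Proof.
move=> v0 Ef Vf.
have VG : 'V_PL[fun w => G w f] = v%:E.
  by rewrite /variance (bridge_covariance bG) Ef mulr0 subr0 -Vf.
have nG : normal_law PL (fun w => G w f).
  have [m [s law]] := bridge_gaussian bG (fun _ : 'I_1 => 1%R) (fun=> f).
  exists m, s => A mA; rewrite -law//; congr (PL (_ @^-1` A)).
  by apply/funext => w; rewrite big_ord1 mul1r.
have [s [s0 law vE]] := centered_normal (bridge_Lfun2 bG f) (bridge_mean bG f)
  v0 VG nG.
exists s; split=> // b; by rewrite -normal_cdfE -law.
Qed.

End bridge_law.

(** The factor [c] is the second moment of the standard normal law; comparing
    the two factorizations of the same variance [v] fixes the scale up to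
    sign. *)
Lemma normal_cdf_unique (R : realType) (s s' v : R) (c : \bar R) : 0 < v ->
  v%:E = ((s ^+ 2)%:E * c)%E -> v%:E = ((s' ^+ 2)%:E * c)%E -> s != 0 -> s' != 0 ->
  normal_cdf s = normal_cdf s'.
Proof.
move=> v0 vs vs' s0 s'0.
suff /eqP : s ^+ 2 = s' ^+ 2.
  by rewrite eqf_sqr => /orP[/eqP ->//|/eqP ->]; rewrite /normal_cdf normal_probN.
have s20 : 0 < s ^+ 2 by rewrite exprn_even_gt0.
case: c vs vs' => [c [vs] [vs']||].
- have c0 : c != 0 by apply: contraTneq v0 => c0; rewrite vs c0 mulr0 ltxx.
  by apply: (mulIf c0); rewrite -vs -vs'.
- by rewrite gt0_muley.
- by rewrite gt0_muleNy.
Qed.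


Unset Implicit Arguments.

Theorem corollary3p10
  (R : realType)
  (* the observation space, a subset of R^d with its sigma-algebra *)
  (d : nat) (dX : measure_display) (X : measurableType dX)
  (emb : X -> 'rV[R]_d) (emb_inj : injective emb)
  (* model, target parameter, nuisance parameter, plug-in map *)
  (M : set (probability X R)) (P0 : probability X R) (P0_in_M : M P0)
  (psi : probability X R -> R)
  (H : Type) (eta : probability X R -> H)
  (T : H -> probability X R -> R) (psi_T : psi P0 = T (eta P0) P0)
  (* influence function *)
  (phi0 : X -> R) (phi0_L2 : phi0 \in Lfun P0 2%:E)
  (phi0_mean : \int[P0]_t phi0 t = 0)
  (sigma0 : R) (sigma0E : sigma0 = Num.sqrt (\int[P0]_t (phi0 t) ^+ 2))
  (sigma0_gt0 : 0 < sigma0)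
  (* data *)
  (dO : measure_display) (Om : measurableType dO) (P : probability Om R)
  (Xs : nat -> Om -> X) (Xs_iid : iid P P0 Xs)
  (* estimators based on the data *)
  (eta_n : forall n, n.+1.-tuple X -> H)
  (phi_n : forall n, n.+1.-tuple X -> X -> R)
  (sigma_n : forall n, n.+1.-tuple X -> R)
  (sigma_n_ge0 : forall n x, 0 <= sigma_n n x)
  (* bootstrap weights and resampling maps *)
  (dW : nat -> measure_display) (W : forall n, measurableType (dW n))
  (Q : forall n, probability (W n) R)
  (gamma : forall n, {mfun (n.+1.-tuple X * W n)%type >-> X})
  (* estimators based on the original and bootstrap data, in this order;
     sigma_star is based on the bootstrap data only *)
  (eta_star : forall n, n.+1.-tuple X -> n.+1.-tuple X -> H)
  (phi_star : forall n, n.+1.-tuple X -> n.+1.-tuple X -> X -> R)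
  (sigma_star : forall n, n.+1.-tuple X -> R)
  (sigma_star_ge0 : forall n xs, 0 <= sigma_star n xs)
  (alpha beta : R) (alpha01 : 0 < alpha < 1) (beta01 : 0 < beta < 1)
  (alpha_beta : alpha + beta < 1) :
  let QW n : probability (n.+1.-tuple (W n)) R := tuple_prob (Q n) n.+1 in
  let x n om := sample Xs n om in
  let xs n om w := boot_sample (gamma n) (x n om) w in
  let Pn n om : probability X R := empirical (x n om) in
  let Phat n om := boot_law (gamma n) (Q n) (x n om) in
  let Pstar n om w : probability X R := empirical (xs n om w) in
  let f n om := phi_n n (x n om) in
  let fs n om w := phi_star n (x n om) (xs n om w) in
  let psi_n n om := T (eta_n n (x n om)) (Pn n om) in
  let psi_hat n om := T (eta_n n (x n om)) (Phat n om) in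
  let psi_star n om w := T (eta_star n (x n om) (xs n om w)) (Pstar n om w) in
  let Rem n om := psi_n n om - T (eta P0) P0
    - (\int[Pn n om]_t f n om t - \int[P0]_t f n om t) in
  let Rem_star n om w := psi_star n om w - psi_hat n om
    - (\int[Pstar n om w]_t fs n om w t - \int[Phat n om]_t fs n om w t) in
  let CI (s : forall n, n.+1.-tuple X -> R)
         (s_star : forall n, n.+1.-tuple X -> R) n om :=
    boot_interval (QW n) (psi_n n om) (s n (x n om))
      (fun w => (psi_star n om w - psi_hat n om) / s_star n (xs n om w))
      alpha beta in
  let one n (_ : n.+1.-tuple X) : R := 1 in
  (* (A1) *)
  (exists F : set (X -> R),
    [/\ (forall g, F g -> measurable_fun [set: X] g), F phi0,
        inner_prob P [set om | F (f n om)] @[n --> \oo] --> 1%E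
      & cvg_to_bridge P0 F P (fun n om => scaled_diff n (Pn n om) P0)]) ->
  (* (A2) *)
  littleo_outer P
    (fun n om => Lnorm P0 2%:E (EFin \o (f n om \- phi0))) (fun=> 1) ->
  (* (A3) *)
  littleo_outer P (fun n om => (Rem n om)%:E) rate ->
  (* (B1) *)
  (exists F : set (X -> R),
    [/\ (forall g, F g -> measurable_fun [set: X] g), F phi0,
        cvg_outer_prob P
          (fun n om => inner_prob (QW n) [set w | F (fs n om w)]) 1
      & cond_cvg_to_bridge P0 F P QW
          (fun n om w => scaled_diff n (Pstar n om w) (Phat n om))]) ->
  (* (B2) *)
  cond_littleo_outer P QW
    (fun n om w => Lnorm P0 2%:E (EFin \o (fs n om w \- phi0))) (fun=> 1) ->
  (* (B3) *)
  cond_littleo_outer P QW (fun n om w => (Rem_star n om w)%:E) rate ->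
  asymptotic_level P (CI one one) (psi P0) (1 - alpha - beta) /\
  (cvg_outer_prob P (fun n om => ((sigma_n n (x n om)) ^+ 2)%:E) (sigma0 ^+ 2) ->
   cond_littleo_outer P QW
     (fun n om w => ((sigma_star n (xs n om w)) ^+ 2 - sigma0 ^+ 2)%:E)
     (fun=> 1) ->
   asymptotic_level P (CI sigma_n sigma_star) (psi P0) (1 - alpha - beta)).
Proof.
move=> QW x xs Pn Phat Pstar f fs psi_n psi_hat psi_star Rem Rem_star CI one.
move=> [F1 [_ F1phi inF1 [dL1 [OmL1 [PL1 [G1 [bG1 [Z1 [Z1A Z1G1]]]]]]]]] A2 A3.
move=> [F2 [_ F2phi inF2 [dL2 [OmL2 [PL2 [G2 [bG2 [Z2 [Z2A Z2G2]]]]]]]]] B2 B3.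
pose phi1 : F1 := exist _ phi0 (mem_set F1phi).
pose phi2 : F2 := exist _ phi0 (mem_set F2phi).
have var_gt0 : 0 < \int[P0]_t (phi0 t) ^+ 2.
  by rewrite -sqrtr_gt0 -sigma0E.
have [s1 [s10 law1 var1]] := bridge_coordinate_law bG1 (f := phi1) var_gt0
  phi0_mean (erefl _).
have [s2 [s20 law2 var2]] := bridge_coordinate_law bG2 (f := phi2) var_gt0
  phi0_mean (erefl _).
have cdf12 := normal_cdf_unique var_gt0 var1 var2 s10 s20.
pose r n : R := Num.sqrt n.+1%:R.
have r_gt0 n : 0 < r n by rewrite sqrtr_gt0.
have cvg1 := weak_cvg_law (bridge_measurable bG1) Z1G1.
have cvg2 := cond_weak_cvg_law (bridge_measurable bG2) Z2G2.
(* The data play the role of the weights here: the first space is ignored. *)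
have lin1 : forall e : R, 0 < e -> cond_vanishing P (fun=> P) (fun n _ =>
    [set om | e <= `|r n * (psi_n n om - psi P0) - Z1 n om phi1|]).
  apply: (cond_linearization bG1 cvg1 (f := fun n _ om => f n om)
    (A := fun n _ om => scaled_diff n (Pn n om) P0)).
  - by move=> n _ om g; exact: Z1A.
  - exact/cond_vanishing_cst/vanishing_inner_prob.
  - move=> delta d0; apply/cond_vanishing_cst; apply: vanishing_sub (A2 _ d0).
    move=> n om /= h; rewrite invr1 mule1 sube0 gee0_abs//.
    exact: Lnorm_ge0.
  - move=> e e0; apply/cond_vanishing_cst; apply: vanishing_sub (A3 _ e0).
    move=> n om /= h; rewrite lee_fin subr0; apply: le_trans h _.
    rewrite /rate invrK /scaled_diff -mulrBr -/(r n) mulrC psi_T.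
    by rewrite lexx.
have lin2 : forall e : R, 0 < e -> cond_vanishing P QW (fun n om =>
    [set w | e <= `|r n * (psi_star n om w - psi_hat n om) - Z2 n om w phi2|]).
  apply: (cond_linearization bG2 cvg2 (f := fs)
    (A := fun n om w => scaled_diff n (Pstar n om w) (Phat n om))).
  - by move=> n om w g; exact: Z2A.
  - exact: cond_vanishing_inner_prob.
  - move=> delta d0; apply: cond_vanishing_sub (B2 _ d0) => n om w /= h.
    by rewrite invr1 mule1 gee0_abs// Lnorm_ge0.
  - move=> e e0; apply: cond_vanishing_sub (B3 _ e0) => n om w /= h.
    rewrite lee_fin; apply: le_trans h _.
    rewrite /rate invrK /scaled_diff -mulrBr -/(r n) normrM gtr0_norm//.
    by rewrite mulrC lexx.
pose Phi := normal_cdf s1.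
have Phi_increasing := normal_cdf_increasing s10.
have Phi_quantile := normal_quantile s10.
have Phi_continuous := normal_cdf_continuous s10.
have root_law (a b : R) (E : nat -> set Om) : a < b ->
  (forall e : R, 0 < e -> vanishing P (fun n =>
     [set om | E n om /\ ~ (a - e <= r n * (psi_n n om - psi P0) <= b + e)])) ->
  (forall e : R, 0 < e -> vanishing P (fun n =>
     [set om | ~ E n om /\ a + e <= r n * (psi_n n om - psi P0) <= b - e])) ->
  outer_prob P (E n) @[n --> \oo] --> (Phi b - Phi a)%:E.
  move=> ab Eup Elo; apply/cvg_outer_prob_outer_prob.
  apply: (cond_portmanteau_interval (bridge_measurable bG1) cvg1
    (T := fun z : linfty R F1 => z phi1) _ law1 Phi_continuous lin1 ab).
  - by move=> z z'; exact: linfty_dist_ge.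
  - by move=> e e0; apply/cond_vanishing_cst; exact: Eup.
  - by move=> e e0; apply/cond_vanishing_cst; exact: Elo.
have root_star_law (b : R) (E : forall n, Om -> set (n.+1.-tuple (W n))) :
  (forall e : R, 0 < e -> cond_vanishing P QW (fun n om =>
     [set w | E n om w /\ b + e < r n * (psi_star n om w - psi_hat n om)])) ->
  (forall e : R, 0 < e -> cond_vanishing P QW (fun n om =>
     [set w | ~ E n om w /\ r n * (psi_star n om w - psi_hat n om) < b - e])) ->
  cvg_outer_prob P (fun n om => outer_prob (QW n) (E n om)) (Phi b).
  rewrite /Phi cdf12.
  apply: (cond_portmanteau_left (bridge_measurable bG2) cvg2
    (T := fun z : linfty R F2 => z phi2) _ law2 _ lin2).
  - by move=> z z'; exact: linfty_dist_ge.
  - exact: normal_cdf_continuous.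
have level := boot_interval_level Phi_increasing Phi_quantile r_gt0 root_law
  root_star_law.
split; last move=> ss sstar.
- have s_cst (e : R) : 0 < e -> vanishing P (fun=> [set om | e <= `|1 - 1 : R|]).
    move=> e0; apply: vanishing_empty => n om /=.
    by rewrite subrr normr0 leNgt e0.
  have s_star_cst (e : R) : 0 < e -> cond_vanishing P QW
      (fun n om => [set w | e <= `|1 - 1 : R|]).
    move=> e0; apply: cond_vanishing_empty => n om w /=.
    by rewrite subrr normr0 leNgt e0.
  have := level (fun _ _ => 1) (fun _ _ _ => 1) 1 ltr01 s_cst s_star_cst
    alpha beta alpha01 beta01 alpha_beta.
  exact.
- have s_cvg := vanishing_sqr sigma0_gt0 (fun n om => sigma_n_ge0 n _) ss.
  have s_star_cvg := cond_vanishing_sqr sigma0_gt0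
    (fun n om w => sigma_star_ge0 n _) sstar.
  have := level _ _ sigma0 sigma0_gt0 s_cvg s_star_cvg
    alpha beta alpha01 beta01 alpha_beta.
  exact.
Qed.
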